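(* When the dimension $d$ is a constant, the randomized communication complexity of linear programming is $\tilde{\Theta}(sL)$ in the coordinator model and $\tilde{\Omega}(s+L)$ in the blackboard model. The upper bound allows the coordinator to output a solution vector $x \in \mathbb{R}^d$, while the lower bounds hold already for testing whether the linear program is feasible. Here $\tilde{\Theta}(\cdot)$ and $\tilde{\Omega}(\cdot)$ suppress only $\mathrm{polylog}(sL)$ factors.
   Context: Distributed linear programming: there are $s\ge 2$ servers $P_1,\dots,P_s$ and a coordinator. The constraints $Ax \le b$ of a linear program in $d$ variables ($A\in\mathbb{R}^{n\times d}$, $b \in \mathbb{R}^n$, all entries integers specified with $L$ bits, as is the objective vector $c\in\mathbb{R}^d$) are partitioned row-wise among the servers, server $P_i$ holding $A^{(i)}x \le b^{(i)}$. The goal is for the coordinator to output $x$ maximizing (or minimizing) $c^Tx$ subject to $Ax\le b$; in the feasibility testing problem the coordinator must report whether $Ax \le b$ is feasible. In the coordinator model each server communicates only with the coordinator via a private two-way channel; in the blackboard model all messages are broadcast on a shared blackboard whose contents determine who speaks next. Communication complexity is the total number of bits sent; randomized protocols must succeed with constant probability on every input.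
   Formalization: The lower bounds (coordinator and blackboard) are stated only for dimension d at least 2, since for d = 1 and s = 2 feasibility reduces to comparing numbers and takes only O(log L) randomized bits; the upper bound is stated for every d at least 1. *)

(* Defs.v *)
From mathcomp Require Import all_boot all_order all_algebra.
From mathcomp Require Import boolp classical_sets reals ereal exp.

Set Implicit Arguments.
Unset Strict Implicit.
Unset Printing Implicit Defensive.

Import Order.TTheory GRing.Theory Num.Theory.
Local Open Scope classical_set_scope.
Local Open Scope ring_scope.

(** * Distributed problems

    [s] servers each hold an input of type [server_input]; the coordinator
    holds [coord_input] and has to produce a correct [answer]. *)

Record problem (s : nat) := Problem {
  server_input : Type;
  coord_input : Type;
  answer : Type;
  correct : ('I_s -> server_input) -> coord_input -> answer -> Prop }.

(** * Coordinator model

    A server sees only the content of its own channel; the coordinator sees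
    every channel.  One bit is exchanged at a time.  Who sends the next bit on
    the channel of server [i] is a function [channel_turn] of the content of
    that channel alone ([true]: the server sends), so both ends know it, the
    sender of each past bit is determined by the content, and no information
    is conveyed without sending a bit.  The coordinator chooses which channel
    is used next, or stops with an answer.  The order in which the bits of
    different channels were exchanged need not be recorded: it can be replayed
    from [y] and the contents of the channels. *)

Record coord_protocol (s : nat) (X Y O : Type) := CoordProtocol {
  coord_next : Y -> ('I_s -> seq bool) -> 'I_s + O;
  coord_bit : Y -> ('I_s -> seq bool) -> 'I_s -> bool;
  channel_turn : 'I_s -> seq bool -> bool;
  server_bit : 'I_s -> X -> seq bool -> bool }.

Section CoordinatorRun.
Variables (s : nat) (X Y O : Type) (P : coord_protocol s X Y O).
Variables (x : 'I_s -> X) (y : Y).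

Definition coord_new_bit (h : 'I_s -> seq bool) (i : 'I_s) : bool :=
  if channel_turn P i (h i) then server_bit P i (x i) (h i)
  else coord_bit P y h i.

(* [Some a]: the answer [a] is output after at most [n] further bits. *)
Fixpoint coord_run_from (h : 'I_s -> seq bool) (n : nat) : option O :=
  match coord_next P y h, n with
  | inr a, _ => Some a
  | inl _, 0%N => None
  | inl i, n'.+1 =>
      coord_run_from
        (fun j => if j == i then rcons (h i) (coord_new_bit h i) else h j) n'
  end.

Definition coord_run : nat -> option O := coord_run_from (fun _ => [::]).

End CoordinatorRun.

(** * Blackboard model

    The content of the blackboard alone determines who writes the next bit, or
    that the protocol stops; the coordinator then outputs an answer. *)

Inductive speaker (s : nat) :=
  | CoordinatorSpeaks
  | ServerSpeaks of 'I_s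
  | NobodySpeaks.
Arguments CoordinatorSpeaks {s}.
Arguments NobodySpeaks {s}.

Record board_protocol (s : nat) (X Y O : Type) := BoardProtocol {
  board_next : seq bool -> speaker s;
  board_coord_bit : Y -> seq bool -> bool;
  board_server_bit : 'I_s -> X -> seq bool -> bool;
  board_output : Y -> seq bool -> O }.

Section BoardRun.
Variables (s : nat) (X Y O : Type) (P : board_protocol s X Y O).
Variables (x : 'I_s -> X) (y : Y).

Fixpoint board_run_from (h : seq bool) (n : nat) : option O :=
  match board_next P h, n with
  | NobodySpeaks, _ => Some (board_output P y h)
  | _, 0%N => None
  | CoordinatorSpeaks, n'.+1 =>
      board_run_from (rcons h (board_coord_bit P y h)) n'
  | ServerSpeaks i, n'.+1 =>
      board_run_from (rcons h (board_server_bit P i (x i) h)) n'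
  end.

Definition board_run : nat -> option O := board_run_from [::].

End BoardRun.

(** * Randomness

    A randomized protocol is a deterministic one that depends on a public
    random string and in which every party reads its own private random string
    together with its input.  With private coins only, the public string is
    empty. *)

Inductive coin_model := PrivateCoins | PublicCoins.

Definition allowed_public_bits (cm : coin_model) (p : nat) : Prop :=
  match cm with PrivateCoins => p = 0%N | PublicCoins => True end.

Record coins (s p m : nat) := Coins {
  public_coins : p.-tuple bool;
  coord_coins : m.-tuple bool;
  server_coins : {ffun 'I_s -> m.-tuple bool} }.

Definition coins_of s p m
    (w : p.-tuple bool * m.-tuple bool * {ffun 'I_s -> m.-tuple bool}) :
    coins s p m :=
  Coins w.1.1 w.1.2 w.2.

(* The protocol always stops, and with probability at least 2/3 over uniformly
   random coins it outputs a good answer. *)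
Definition succeeds s p m (O : Type) (run : coins s p m -> option O)
    (good : O -> Prop) : Prop :=
  (forall w, run w <> None) /\
  (2 * #|[set: p.-tuple bool * m.-tuple bool * {ffun 'I_s -> m.-tuple bool}]%SET|
   <= 3 * #|[set w | `[< exists2 a, run (coins_of w) = Some a & good a >]]%SET|)%N.

(* Some randomized protocol sends at most [n] bits on every input and all
   coins, and outputs a correct answer with probability at least 2/3 on every
   input. *)
Definition coord_solvable (cm : coin_model) s (Q : problem s) (n : nat) : Prop :=
  exists (p m : nat)
    (P : p.-tuple bool ->
         coord_protocol s (server_input Q * m.-tuple bool)
           (coord_input Q * m.-tuple bool) (answer Q)),
    allowed_public_bits cm p /\
    forall (x : 'I_s -> server_input Q) (y : coord_input Q),
      succeeds
        (fun w : coins s p m =>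
           coord_run (P (public_coins w))
             (fun i => (x i, server_coins w i)) (y, coord_coins w) n)
        (correct x y).

Definition board_solvable (cm : coin_model) s (Q : problem s) (n : nat) : Prop :=
  exists (p m : nat)
    (P : p.-tuple bool ->
         board_protocol s (server_input Q * m.-tuple bool)
           (coord_input Q * m.-tuple bool) (answer Q)),
    allowed_public_bits cm p /\
    forall (x : 'I_s -> server_input Q) (y : coord_input Q),
      succeeds
        (fun w : coins s p m =>
           board_run (P (public_coins w))
             (fun i => (x i, server_coins w i)) (y, coord_coins w) n)
        (correct x y).

(** * Randomized communication complexity ([+oo] if there is no protocol) *)

Definition coord_complexity (R : realType) (cm : coin_model) s (Q : problem s)
    : \bar R :=
  ereal_inf [set (n%:R : R)%:E | n in [set n | coord_solvable cm Q n]].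

Definition board_complexity (R : realType) (cm : coin_model) s (Q : problem s)
    : \bar R :=
  ereal_inf [set (n%:R : R)%:E | n in [set n | board_solvable cm Q n]].

(** * Linear programs *)

(* The rows held by one server, an arbitrary number of them; an integer
   specified with [L] bits has absolute value less than [2 ^ L]. *)
Record constraints (d L : nat) := Constraints {
  nrows : nat;
  lhs : 'M[int]_(nrows, d);
  rhs : 'cV[int]_nrows;
  lhs_bits : forall i j, `|lhs i j| < 2 ^+ L;
  rhs_bits : forall i, `|rhs i 0| < 2 ^+ L }.

Record objective (d L : nat) := Objective {
  obj_coef : 'cV[int]_d;
  obj_bits : forall j, `|obj_coef j 0| < 2 ^+ L }.

Section LinearProgram.
Variables (R : realType) (d L s : nat).

Definition feasible (K : 'I_s -> constraints d L) (x : 'cV[R]_d) : Prop :=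
  forall (i : 'I_s) (k : 'I_(nrows (K i))),
    (map_mx intr (lhs (K i)) *m x) k 0 <= (rhs (K i) k 0)%:~R.

Definition obj_value (c : objective d L) (x : 'cV[R]_d) : R :=
  ((map_mx intr (obj_coef c))^T *m x) 0 0.

Inductive lp_answer :=
  | Infeasible
  | Unbounded
  | Optimal of 'cV[R]_d.

(* Minimizing is maximizing with the objective negated. *)
Definition lp_correct (K : 'I_s -> constraints d L) (c : objective d L)
    (a : lp_answer) : Prop :=
  match a with
  | Infeasible => forall x, ~ feasible K x
  | Unbounded => forall t : R, exists2 x, feasible K x & t < obj_value c x
  | Optimal x =>
      feasible K x /\ forall z, feasible K z -> obj_value c z <= obj_value c x
  end.

Definition linear_programming : problem s :=
  Problem lp_correct.

Definition lp_feasibility : problem s :=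
  Problem (fun (K : 'I_s -> constraints d L) (_ : unit) (a : bool) =>
             a = true <-> exists x, feasible K x).

End LinearProgram.

(** * Asymptotics in the number [s >= 2] of servers and the bit length [L >= 1],
    up to factors polylogarithmic in [s * L] *)

Section Asymptotics.
Variable R : realType.

Definition tilde_O (f : nat -> nat -> \bar R) (g : nat -> nat -> R) : Prop :=
  exists (C : R) (k : nat), 0 < C /\
    forall s L : nat, (2 <= s)%N -> (1 <= L)%N ->
      (f s L <= (C * ln (s * L)%N%:R ^+ k * g s L)%:E)%E.

Definition tilde_Omega (f : nat -> nat -> \bar R) (g : nat -> nat -> R) : Prop :=
  exists (C : R) (k : nat), 0 < C /\
    forall s L : nat, (2 <= s)%N -> (1 <= L)%N ->
      ((C * g s L / ln (s * L)%N%:R ^+ k)%:E <= f s L)%E.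

Definition tilde_Theta (f : nat -> nat -> \bar R) (g : nat -> nat -> R) : Prop :=
  tilde_O f g /\ tilde_Omega f g.

End Asymptotics.

(* Main.v *)
(** Upper bound.  The optimum of a linear program, when it exists, is attained
    at a point with coordinates [p / q], [|p|, q <= 2 ^ O(L)].  All parties keep
    a common simplex containing the points of this kind that can still be
    optimal.  If its centroid violates a constraint, the server holding it
    announces which part of the simplex is cut off; the barycentric coefficients
    of the cut are rounded to a grid of constant size, so this costs O(1) bits.
    If no server objects, the centroid is feasible and the objective is used as
    the cut.  As in the method of Yamnitsky and Levin, a smaller simplex contains
    what is left, its volume being smaller by a constant factor.  When the
    volume drops below the least volume 2 ^ -O(L) of a nondegenerate simplex of
    candidates, they lie on a hyperplane and the dimension drops.  This gives
    O(L) rounds of O(s) bits.  Unboundedness is decided by the recession program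
    [A r <= 0], [c r <= 1].

    Lower bounds.  Let one server hold a point [t] of a parabola and each other
    server a set of points that it excludes by tangent lines.  If no server
    excludes [t], each channel must carry enough bits to distinguish this from
    the case where that server excludes [t]; as the transcripts of a
    channel split the inputs into combinatorial rectangles, whose discrepancy is
    small, this takes Omega(L) bits on average over the legal inputs.  For small
    [L] one uses that a server which is never heard could hold a
    contradiction. *)

Require Import Defs.
From mathcomp Require Import all_boot all_order all_algebra.
From mathcomp Require Import boolp classical_sets reals ereal exp.
From mathcomp Require Import perm ring lra zify.

Set Implicit Arguments.
Unset Strict Implicit.
Unset Printing Implicit Defensive.
Import Order.TTheory GRing.Theory Num.Theory.
Local Open Scope ring_scope.

(** * Searching by hyperplane cuts *)

Definition dot (R : pzRingType) n (a : 'rV[R]_n) (x : 'cV[R]_n) : R := (a *m x) 0 0.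

Lemma dotDr (R : pzRingType) n (a : 'rV[R]_n) x y : dot a (x + y) = dot a x + dot a y.
Proof. by rewrite /dot mulmxDr mxE. Qed.

Lemma dotZr (R : comPzRingType) n (a : 'rV[R]_n) k x : dot a (k *: x) = k * dot a x.
Proof. by rewrite /dot -scalemxAr mxE. Qed.

Lemma dotNr (R : pzRingType) n (a : 'rV[R]_n) x : dot a (- x) = - dot a x.
Proof. by rewrite /dot mulmxN mxE. Qed.

Lemma dotNl (R : pzRingType) n (a : 'rV[R]_n) x : dot (- a) x = - dot a x.
Proof. by rewrite /dot mulNmx mxE. Qed.

Lemma dot_sumr (R : pzRingType) n (a : 'rV[R]_n) I r (P : pred I) (F : I -> 'cV[R]_n) :
  dot a (\sum_(i <- r | P i) F i) = \sum_(i <- r | P i) dot a (F i).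
Proof. by rewrite /dot mulmx_sumr summxE. Qed.

Lemma dotE (R : pzRingType) n (a : 'rV[R]_n) x : dot a x = \sum_i a 0 i * x i 0.
Proof. by rewrite /dot mxE. Qed.

Section Search.
Variable R : realType.

(* A search for an unknown point of [W] in [n] queries: if every [x] still
   wanted satisfies [a x < a z] for some [a], then the answer to the query [z]
   is a [j] such that [W' j] retains these points. *)
Fixpoint searchable (J : finType) d n (W : 'cV[R]_d -> Prop) : Prop :=
  if n is n'.+1 then
    exists (z : 'cV[R]_d) (W' : J -> 'cV[R]_d -> Prop),
      (forall j, searchable J n' (W' j)) /\
      forall a : 'rV[R]_d, exists j, forall x, W x -> dot a x < dot a z -> W' j x
  else forall x, ~ W x.

(** A cut [a] at an image point is the cut [a *m G] at its preimage, so the search runs in the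
    parameter space. This is what lets the dimension drop. *)
Lemma searchable_affine (J : finType) n d e (G : 'M[R]_(d, e)) (g : 'cV[R]_d)
    (W : 'cV[R]_d -> Prop) (W' : 'cV[R]_e -> Prop) :
  (forall x, W x -> exists2 u, W' u & x = G *m u + g) ->
  searchable J n W' -> searchable J n W.
Proof.
elim: n W W' => [|n IH] W W' sub /=.
  by move=> W'0 x /sub[u /W'0].
move=> [z [V [sV cV]]]; exists (G *m z + g).
exists (fun j x => exists2 u, V j u & x = G *m u + g); split=> [j|a].
  exact: IH (sV j).
have [j Hj] := cV (a *m G); exists j => x /sub[u Wu ->].
rewrite !dotDr ltrD2r /dot !mulmxA => lt; exists u => //.
exact: Hj.
Qed.

Lemma searchable_sub (J : finType) n d (W W' : 'cV[R]_d -> Prop) :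
  (forall x, W x -> W' x) -> searchable J n W' -> searchable J n W.
Proof.
move=> sub; apply: (@searchable_affine _ _ _ _ 1%:M 0) => x /sub W'x.
by exists x => //; rewrite mul1mx addr0.
Qed.

Lemma searchable0 (J : finType) (j0 : J) n d (W : 'cV[R]_d -> Prop) :
  (forall x, ~ W x) -> searchable J n W.
Proof.
elim: n W => [//|n IH] W W0 /=; exists 0, (fun _ _ => False); split=> [j|a].
  by apply: IH => x [].
by exists j0 => x /W0.
Qed.

Lemma searchable_leq (J : finType) (j0 : J) n m d (W : 'cV[R]_d -> Prop) :
  (n <= m)%N -> searchable J n W -> searchable J m W.
Proof.
elim: n m W => [|n IH] m W; first by move=> _ /searchable0; apply.
case: m => // m; rewrite ltnS => le_nm [z [V [sV cV]]].
by exists z, V; split=> [j|]; [exact: IH (sV j)|exact: cV].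
Qed.

(** Letters outside the image of [f] retain nothing. The search in a lower dimension can thus use
    the alphabet of a higher one. *)
Lemma searchable_inj (J J' : finType) (f : J -> J') n d (W : 'cV[R]_d -> Prop) :
  injective f -> searchable J n W -> searchable J' n W.
Proof.
move=> injf; elim: n W => [//|n IH] W /= [z [V [sV cV]]].
have [j0 _] := cV 0.
exists z, (fun j' x => exists2 j, f j = j' & V j x); split=> [j'|a].
  have [[j fj]|nj] := pselect (exists j, f j = j').
    apply: searchable_sub (IH _ (sV j)) => x [i]; rewrite -fj => /injf -> //.
  by apply: (searchable0 (f j0)) => x [j fj _]; apply: nj; exists j.
have [j Hj] := cV a; exists (f j) => x Wx lt; exists j => //; exact: Hj.
Qed.

End Search.

(** A finite family from [A] of maximal rank spans all of [A], even if [A] is infinite. If it has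
    full rank, some of its rows form an invertible matrix; otherwise a nonzero column of its
    cokernel is a normal. *)
Lemma spanning_or_hyperplane (F : fieldType) n (A : 'rV[F]_n -> Prop) :
  (exists2 h : 'cV[F]_n, h != 0 & forall x, A x -> x *m h = 0) \/
  (exists2 M : 'M[F]_n, (forall i, A (row i M)) & M \in unitmx).
Proof.
pose Q r := exists m (P : 'M[F]_(m, n)), (forall i, A (row i P)) /\ \rank P = r.
have Q0 : exists r, `[< Q r >].
  by exists 0%N; apply/asboolP; exists 0%N, 0; split=> [[]//|]; rewrite mxrank0.
have Qn r : `[< Q r >] -> (r <= n)%N.
  by move=> /asboolP[m [P [_ <-]]]; exact: rank_leq_col.
case: (ex_maxnP Q0 Qn) => r /asboolP[m [P [AP rP]]] max_r.
have spanP x : A x -> (x <= P)%MS.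
  move=> Ax.
  have : `[< Q (\rank (col_mx P x)) >].
    apply/asboolP; exists (m + 1)%N, (col_mx P x); split=> // i.
    case: (split_ordP i) => j ->; first by rewrite rowKu.
    by rewrite rowKd row_id.
  move=> /max_r; rewrite -rP => le.
  have PP : (P <= col_mx P x)%MS by rewrite -addsmxE addsmxSl.
  have := geq_leqif (mxrank_leqif_eq PP); rewrite le => /esym/andP[_].
  by apply: submx_trans; rewrite -addsmxE addsmxSr.
have [fullP|nfull] := boolP (row_full P).
  right; exists (rowsub (fullrankfun fullP) P); last exact: fullrowsub_unit.
  by move=> i; rewrite row_rowsub.
left.
have : cokermx P != 0.
  by rewrite -mxrank_eq0 mxrank_coker subn_eq0 -ltnNge ltn_neqAle rank_leq_col andbT.
case/matrix0Pn => i [j nz]; exists (col j (cokermx P)).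
  by apply/cV0Pn; exists i; rewrite mxE.
move=> x /spanP; rewrite submxE => /eqP x0.
by rewrite colE mulmxA x0 mul0mx.
Qed.

(** * Simplices in homogeneous coordinates: determinants, a bounding simplex, and shrinking *)

Section Simplex.
Variable R : realType.

(** Homogeneous coordinates turn affine combinations of points into linear ones of rows; the
    determinant of [hom_mx] is up to sign d! times the volume of the simplex. *)
Definition hvec d (x : 'cV[R]_d) : 'rV[R]_(1 + d) := row_mx 1%:M x^T.

Definition hom_mx d (V : 'I_d.+1 -> 'cV[R]_d) : 'M[R]_d.+1 := \matrix_i hvec (V i).

Definition in_simplex d (V : 'I_d.+1 -> 'cV[R]_d) (x : 'cV[R]_d) : Prop :=
  exists l : 'I_d.+1 -> R,
    [/\ forall i, 0 <= l i, \sum_i l i = 1 & x = \sum_i l i *: V i].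

Lemma hvec_sum d n (V : 'I_n -> 'cV[R]_d) (l : 'I_n -> R) :
  \sum_i l i = 1 -> hvec (\sum_i l i *: V i) = \sum_i l i *: hvec (V i).
Proof.
move=> l1; apply/rowP=> j; rewrite summxE /hvec; case: (split_ordP j) => k ->.
  rewrite row_mxEl mxE (ord1 k) /= -[LHS]l1; apply: eq_bigr => i _.
  by rewrite mxE row_mxEl mxE mulr1.
rewrite row_mxEr mxE summxE; apply: eq_bigr => i _.
by rewrite mxE [RHS]mxE row_mxEr mxE.
Qed.

Lemma hvecZD d (x y : 'cV[R]_d) c :
  hvec (c *: x + (1 - c) *: y) = c *: hvec x + (1 - c) *: hvec y.
Proof.
apply/rowP=> j; rewrite [RHS]mxE ![(_ *: hvec _) 0 j]mxE /hvec.
case: (split_ordP j) => k ->.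
  by rewrite !row_mxEl (ord1 k) mxE /= !mulr1 addrC subrK.
by rewrite !row_mxEr !mxE.
Qed.

Lemma det_le (T : realDomainType) n (A : 'M[T]_n) b :
  0 <= b -> (forall i j, `|A i j| <= b) -> `|\det A| <= n`!%:R * b ^+ n.
Proof.
move=> b0 Ab; apply: le_trans (ler_norm_sum _ _ _) _.
apply: (@le_trans _ _ (\sum_(s : 'S_n) b ^+ n)).
  apply: ler_sum => s _; rewrite normrM normrX normrN1 expr1n mul1r normr_prod.
  rewrite -[X in _ ^+ X](card_ord n) -prodr_const; apply: ler_prod => i _.
  by rewrite normr_ge0 Ab.
by rewrite sumr_const card_Sn mulr_natl.
Qed.

(** The barycentric coordinates of the [P i] form a matrix with entries in [0, 1], whose determinant
    is at most the number of permutations. *)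
Lemma det_in_simplex d (V P : 'I_d.+1 -> 'cV[R]_d) :
  (forall i, in_simplex V (P i)) ->
  `|\det (hom_mx P)| <= d.+1`!%:R * `|\det (hom_mx V)|.
Proof.
move=> /choice[l lP].
have -> : hom_mx P = (\matrix_(i, j) l i j) *m hom_mx V.
  apply/row_matrixP=> i; rewrite row_mul rowK.
  have [_ l1 ->] := lP i; rewrite hvec_sum // mulmx_sum_row.
  by apply: eq_bigr => j _; rewrite rowK !mxE.
rewrite det_mulmx normrM ler_wpM2r // -[leRHS]mulr1 -[X in _ * X](expr1n R d.+1).
apply: det_le => // i j; rewrite mxE.
have [l0 l1 _] := lP i; rewrite ger0_norm // -l1 (bigD1 j) //= lerDl.
exact: sumr_ge0.
Qed.

Definition height_le d b (x : 'cV[R]_d) : Prop :=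
  exists (q : int) (p : 'I_d -> int),
    [/\ 0 < q, q <= 2 ^+ b & forall i, `|p i| <= 2 ^+ b /\ x i 0 * q%:~R = (p i)%:~R].

(** Multiplying each row by its denominator gives an integral matrix, whose nonzero determinant is
    at least 1 in absolute value. *)
Lemma det_height d b (P : 'I_d.+1 -> 'cV[R]_d) :
  (forall i, height_le b (P i)) -> \det (hom_mx P) != 0 ->
  1 <= `|\det (hom_mx P)| * 2 ^+ (b * d.+1).
Proof.
move=> /choice[q /choice[p qpP]] nz.
pose Z : 'M[int]_d.+1 := \matrix_i row_mx (q i)%:M (\row_j p i j).
pose D : 'M[R]_d.+1 := diag_mx (\row_i (q i)%:~R).
have ZE : map_mx intr Z = D *m hom_mx P.
  apply/row_matrixP=> i; rewrite row_mul row_diag_mx -scalemxAl -rowE rowK.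
  rewrite mxE; apply/rowP=> j; rewrite !mxE; case: split => k; rewrite !mxE.
    by rewrite (ord1 k) /= mulr1.
  by have [_ _ /(_ k)[_ <-]] := qpP i; rewrite mulrC.
have DE : \det D = (\prod_i q i)%:~R.
  by rewrite det_diag rmorph_prod; apply: eq_bigr => i _; rewrite mxE.
have detE : (\det Z)%:~R = (\prod_i q i)%:~R * \det (hom_mx P).
  by rewrite -det_map_mx ZE det_mulmx DE.
have q0 : 0 < \prod_i q i by apply: prodr_gt0 => i _; have [] := qpP i.
have Z0 : \det Z != 0.
  rewrite -(intr_eq0 R) detE mulf_neq0 //; by rewrite intr_eq0 gt_eqF.
have qle : \prod_i q i <= 2 ^+ (b * d.+1).
  rewrite exprM -[X in _ ^+ X](card_ord d.+1) -prodr_const; apply: ler_prod => i _.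
  by have [/ltW -> ->] := qpP i.
have : (1 : R) <= `|(\det Z)%:~R|.
  by rewrite -intr_norm ler1z -gtz0_ge1 normr_gt0.
rewrite detE normrM mulrC => /le_trans; apply; apply: ler_wpM2l => //.
rewrite -intr_norm (ger0_norm (ltW q0)).
have -> : 2 ^+ (b * d.+1) = (2 ^+ (b * d.+1) : int)%:~R :> R by rewrite rmorphXn.
by rewrite ler_int.
Qed.

(** A corner simplex with corner (-B, ..., -B) and legs 2dB along the axes, where B = 2^b. In the
    box each offset from the corner is at most 2B, a fraction 1/d of a leg, so the weights of the
    legs sum to at most 1. *)
Lemma simplex_box d b : (0 < d)%N -> exists2 V : 'I_d.+1 -> 'cV[R]_d,
  (forall x : 'cV[R]_d, (forall i, `|x i 0| <= 2 ^+ b) -> in_simplex V x) &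
  `|\det (hom_mx V)| <= d.+1`!%:R * (d.*2%:R * 2 ^+ b) ^+ d.+1.
Proof.
move=> d0; pose B : R := 2 ^+ b.
have B1 : 1 <= B by rewrite exprn_ege1 // ler1n.
have B0 : 0 < B by lra.
have d1 : 1 <= d%:R :> R by rewrite ler1n.
have dn0 : d%:R != 0 :> R by apply/eqP; lra.
pose V (i : 'I_d.+1) : 'cV[R]_d :=
  \col_j (- B + (if unlift ord0 i == Some j then d.*2%:R * B else 0)).
have dB : B <= d%:R * B by rewrite ler_peMl // ltW.
have d2 : d.*2%:R = 2 * d%:R :> R by rewrite -muln2 natrM mulrC.
exists V => [x xB|].
  pose m (j : 'I_d) := (x j 0 + B) / (d.*2%:R * B).
  have m01 j : 0 <= m j <= d%:R^-1.
    have := xB j; rewrite ler_norml -/B => /andP[lo hi]; rewrite /m d2.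
    rewrite divr_ge0 /=; [|lra|lra].
    rewrite ler_pdivrMr; [|lra].
    rewrite (_ : _ * (_ * _) = 2 * B) ?mulrA; last by field.
    lra.
  have sm : \sum_j m j <= 1.
    apply: (@le_trans _ _ (\sum_(j < d) d%:R^-1)).
      by apply: ler_sum => j _; case/andP: (m01 j).
    by rewrite sumr_const card_ord -[_ *+ d]mulr_natr mulVf.
  exists (fun i => if unlift ord0 i is Some j then m j else 1 - \sum_j m j); split.
  - move=> i; case: unlift => [j|]; first by case/andP: (m01 j).
    by rewrite subr_ge0.
  - rewrite big_ord_recl unlift_none; under [X in _ + X]eq_bigr do rewrite liftK.
    by rewrite subrK.
  apply/colP=> k; rewrite summxE big_ord_recl unlift_none.
  under [X in _ = _ + X]eq_bigr do rewrite liftK mxE /V mxE liftK.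
  rewrite !mxE unlift_none addr0 [X in _ = _ + X](bigD1 k) //= eqxx.
  have -> : \sum_(i < d | i != k) m i * (- B + (if Some i == Some k then d.*2%:R * B else 0))
     = - B * \sum_(i < d | i != k) m i.
    rewrite mulr_sumr; apply: eq_bigr => i ik.
    by case: eqP => [[ikE]|_]; [rewrite ikE eqxx in ik|rewrite addr0 mulrC].
  rewrite (bigD1 k) //=; set S := \sum_(i < d | _) _.
  rewrite /m d2; field; apply/andP; split=> //; apply/eqP; lra.
have bd : 1 <= d.*2%:R * B :> R by rewrite d2; lra.
apply: det_le => [|i j]; first exact: le_trans ler01 bd.
rewrite !mxE; case: split => k; rewrite !mxE.
  by rewrite (ord1 k) /= normr1.
case: ifP => _; rewrite ?addr0 ler_norml -/B d2; apply/andP; split; lra.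
Qed.

(** The vertex [V k] stays and the edge towards [V i] is rescaled by [(w i)^-1]. The matrix [D] that
    expresses the old vertices by the new ones is diagonal apart from column [k]. *)
Lemma shrink_det d (V : 'I_d.+1 -> 'cV[R]_d) k (w : 'I_d.+1 -> R) :
  w k = 1 -> (forall i, w i != 0) ->
  \det (hom_mx V) = (\prod_i w i) * \det (hom_mx (fun i => V k + (w i)^-1 *: (V i - V k))).
Proof.
move=> wk w0; pose D : 'M[R]_d.+1 := \matrix_(i, j) (w i *+ (i == j) + (1 - w i) *+ (j == k)).
pose V' i := V k + (w i)^-1 *: (V i - V k); rewrite -/V'.
have V'k : V' k = V k by rewrite /V' subrr scaler0 addr0.
have -> : hom_mx V = D *m hom_mx V'.
  apply/row_matrixP=> i; rewrite row_mul rowK mulmx_sum_row.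
  under eq_bigr do rewrite rowK !mxE scalerDl.
  rewrite big_split /= (bigD1 i) //= eqxx mulr1n big1 ?addr0; last first.
    by move=> j /negbTE; rewrite eq_sym => ->; rewrite mulr0n scale0r.
  rewrite (bigD1 k) //= eqxx mulr1n big1 ?addr0; last first.
    by move=> j /negbTE ->; rewrite mulr0n scale0r.
  rewrite -hvecZD V'k; congr hvec.
  by rewrite /V'; apply/colP=> j; rewrite !mxE; field.
rewrite det_mulmx; congr (_ * _).
rewrite (expand_det_row _ k) (bigD1 k) //= big1 ?addr0; last first.
  by move=> j jk; rewrite mxE eq_sym (negbTE jk) !mulr0n addr0 mul0r.
rewrite mxE eqxx wk subrr mul0rn addr0 mulr1n mul1r /cofactor addnn -mul2n exprM sqrrN expr1n expr1n mul1r.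
have -> : row' k (col' k D) = diag_mx (\row_i w (lift k i)).
  apply/matrixP=> i j; rewrite !mxE (inj_eq lift_inj) [lift k j == k]eq_sym.
  by rewrite (negbTE (neq_lift _ _)) mulr0n addr0.
rewrite det_diag [RHS](bigD1_ord k) //= wk mul1r.
by apply: eq_bigr => i _; rewrite mxE.
Qed.

(** The new barycentric coordinates are [l i * w i], with the defect [1 - \sum_j l j * w j] added at
    vertex [k]. The last hypothesis says exactly that the coordinate there is nonnegative. *)
Lemma shrink_simplex d (V : 'I_d.+1 -> 'cV[R]_d) k (w l : 'I_d.+1 -> R) :
  w k = 1 -> (forall i, 0 < w i) -> (forall i, 0 <= l i) -> \sum_i l i = 1 ->
  \sum_i l i * w i <= 1 + l k ->
  in_simplex (fun i => V k + (w i)^-1 *: (V i - V k)) (\sum_i l i *: V i).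
Proof.
move=> wk w0 l0 l1 lw; pose V' i := V k + (w i)^-1 *: (V i - V k); rewrite -/V'.
exists (fun i => l i * w i + (1 - \sum_j l j * w j) *+ (i == k)); split.
- move=> i; case: eqVneq => [->|_]; last by rewrite mulr0n addr0 mulr_ge0 // ltW.
  by rewrite mulr1n wk; lra.
- rewrite big_split /= [X in _ + X](bigD1 k) //= eqxx mulr1n [X in _ + (_ + X)]big1.
    by rewrite addr0 addrC subrK.
  by move=> i /negbTE ->.
under [RHS]eq_bigr do rewrite scalerDl.
rewrite big_split /= [X in _ = _ + X](bigD1 k) //= eqxx mulr1n.
rewrite [X in _ = _ + (_ + X)]big1 ?addr0; last first.
  by move=> i /negbTE ->; rewrite mulr0n scale0r.
have -> : V' k = V k by rewrite /V' subrr scaler0 addr0.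
have -> : \sum_i (l i * w i) *: V' i
    = (\sum_i l i * w i) *: V k + (\sum_i l i *: V i - (\sum_i l i) *: V k).
  rewrite !scaler_suml -sumrB -big_split; apply: eq_bigr => i _ /=.
  rewrite /V' scalerDr scalerA -mulrA divff ?mulr1 ?gt_eqF // scalerBr //.
rewrite l1 scale1r; apply/colP=> j; rewrite !mxE; ring.
Qed.

Lemma prod_affine_expansion n (a : 'I_n -> R) : exists2 C, 0 <= C &
  forall t, 0 <= t <= 1 ->
    `|\prod_i (1 + t * a i) - (1 + t * \sum_i a i)| <= C * t ^+ 2.
Proof.
elim: n a => [|n IH] a.
  by exists 0 => // t _; rewrite !big_ord0 mulr0 addr0 subrr normr0 mul0r.
have [C C0 HC] := IH (fun i => a (lift ord0 i)).
exists (C * (1 + `|a ord0|) + `|a ord0 * \sum_(i < n) a (lift ord0 i)|) => [|t t01].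
  by rewrite addr_ge0 ?mulr_ge0 ?addr_ge0.
rewrite !big_ord_recl /=; have := HC t t01.
set P := \prod_(i < n) _; set S := \sum_(i < n) _; set x := a ord0 => HP.
rewrite (_ : _ - _ = (P - (1 + t * S)) * (1 + t * x) + (x * S) * t ^+ 2); last by ring.
apply: le_trans (ler_normD _ _) _; have [t0 t1] := andP t01.
rewrite [`|_ * t ^+ 2|]normrM (ger0_norm (sqr_ge0 t)) [leRHS]mulrDl lerD2r.
rewrite normrM mulrAC; apply: ler_pM => //.
apply: le_trans (ler_normD _ _) _; rewrite normr1 lerD2l normrM (ger0_norm t0).
by rewrite ler_piMl.
Qed.

(** At [t = 0] the product is 1 and its derivative is [\sum_i a i]. *)
Lemma prod_affine_gt1 n (a : 'I_n -> R) : 0 < \sum_i a i ->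
  exists2 t, 0 < t < 1 & 1 < \prod_i (1 + t * a i).
Proof.
move=> a0; have [C C0 HC] := prod_affine_expansion a.
(* This [t] is below 1 and satisfies [C * t < S], so the linear gain exceeds the quadratic error. *)
set S := \sum_i a i in a0 HC; pose t := S / (C + S + 1) / 2.
have D0 : 0 < C + S + 1 by lra.
have t0 : 0 < t by rewrite /t !divr_gt0.
have tE : t * (C + S + 1) * 2 = S.
  by rewrite /t; field; apply/eqP; lra.
have t1 : t < 1 by nra.
exists t; first by rewrite t0.
have := HC t; rewrite (ltW t0) (ltW t1) => /(_ isT); rewrite ler_norml => /andP[+ _].
have : C * t ^+ 2 < t * S by rewrite expr2; nra.
lra.
Qed.

End Simplex.

(** * Rounded cuts through the centroid and the shrinking they give *)

Section Cuts.
Variable R : realType.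

(** Rates below 1 have a maximum below 1 over a finite index set; rounding cuts to finitely many
    codes makes the shrinking uniform in this way. The starting value [2^-1] keeps the rate
    positive. *)
Lemma finite_rate (I : finType) (P : I -> R -> Prop) :
  (forall i r r', P i r -> r <= r' -> P i r') ->
  (forall i, exists2 r, r < 1 & P i r) ->
  exists2 r, 0 < r < 1 & forall i, P i r.
Proof.
move=> mono H; have /choice[f fP] i : exists r, r < 1 /\ P i r.
  by have [r r1 Pr] := H i; exists r.
exists (\big[Order.max/2^-1]_i f i).
  apply/andP; split; first by apply: (@lt_le_trans _ _ 2^-1); rewrite ?invr_gt0 ?bigmax_ge_id.
  by apply: bigmax_lt => [|i _]; [lra|case: (fP i)].
by move=> i; apply: mono (le_bigmax _ _ i); case: (fP i).
Qed.

(* The grid of a rounded cut: an affine function on the simplex with minimum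
   [0] and mean [1] at the vertices is rounded down to multiples of [1 / grid]. *)
Definition grid d : nat := d.+1.*2.

(** Nonnegative values with mean 1 at [d.+1] vertices are at most [d.+1], hence the range. *)
Definition cut_code d : finType := {ffun 'I_d.+1 -> 'I_(grid d * d.+1).+1}.

(** The minimum 0 is at [k], and rounding has taken at most 1 per vertex from the total
    [grid d * d.+1]. *)
Definition proper_cut d (q : cut_code d) (k : 'I_d.+1) : Prop :=
  q k = 0%N :> nat /\ ((grid d).-1 * d.+1 <= \sum_i q i)%N.

(** A step in the manner of Yamnitsky and Levin: keep vertex [k] and rescale the other edges by
    weights [w i = 1 + t * a i] whose product exceeds 1. *)
Lemma proper_cut_shrinks d : exists2 r : R, 0 < r < 1 &
  forall (q : cut_code d) k (V : 'I_d.+1 -> 'cV[R]_d), proper_cut q k ->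
  exists2 V', `|\det (hom_mx V')| <= r * `|\det (hom_mx V)| &
    forall l : 'I_d.+1 -> R, (forall i, 0 <= l i) -> \sum_i l i = 1 ->
      \sum_i l i * (q i)%:R <= (grid d)%:R -> in_simplex V' (\sum_i l i *: V i).
Proof.
have M0 : 0 < (grid d)%:R :> R by rewrite ltr0n.
have Mn0 : (grid d)%:R != 0 :> R by rewrite gt_eqF.
have [] := @finite_rate (cut_code d * 'I_d.+1)%type (fun qk r =>
  forall V : 'I_d.+1 -> 'cV[R]_d, proper_cut qk.1 qk.2 ->
  exists2 V', `|\det (hom_mx V')| <= r * `|\det (hom_mx V)| &
    forall l : 'I_d.+1 -> R, (forall i, 0 <= l i) -> \sum_i l i = 1 ->
      \sum_i l i * (qk.1 i)%:R <= (grid d)%:R -> in_simplex V' (\sum_i l i *: V i)).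
- move=> qk r r' H le V /(H V)[V' le' HV']; exists V' => //.
  by apply: le_trans le' _; apply: ler_wpM2r.
- move=> [q k] /=; have [pc|npc] := pselect (proper_cut q k); last first.
    by exists 0 => // V /npc.
  have [qk qs] := pc.
  (* The sum of [a] is at least [1 - d.+1 / grid d], which is 1/2 for this grid. The last summand
     spends the slack [l k] allowed by [shrink_simplex], and it makes [a k = 0]. *)
  pose a (i : 'I_d.+1) : R := (q i)%:R / (grid d)%:R - 1 + (i == k)%:R.
  have sa : 0 < \sum_i a i.
    rewrite big_split /= [X in _ + X](bigD1 k) //= eqxx [X in _ + (_ + X)]big1; last first.
      by move=> i /negbTE ->.
    rewrite addr0 sumrB sumr_const card_ord -mulr_suml -natr_sum.
    have : (((grid d).-1 * d.+1)%N%:R : R) <= (\sum_i (q i : nat))%N%:R by rewrite ler_nat.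
    set S := (\sum_i _)%N.
    have gE : (grid d).-1 = (d * 2 + 1)%N by rewrite /grid doubleS addn1 muln2.
    have gE' : (grid d)%:R = 2 * (d%:R + 1) :> R.
      by rewrite /grid -muln2 natrM mulrC -(natr1 d).
    rewrite gE natrM natrD natrM -(natr1 d) gE' => HS.
    have d0 : 0 <= d%:R :> R by [].
    have : S%:R / (2 * (d%:R + 1)) >= d%:R + 1 / 2 :> R.
      by rewrite ler_pdivlMr; nra.
    rewrite [true%:R]/=; lra.
  have [t /andP[t0 t1] pt] := prod_affine_gt1 sa.
  pose w i := 1 + t * a i.
  have wk : w k = 1 by rewrite /w /a eqxx qk mul0r add0r addNr mulr0 addr0.
  have w0 i : 0 < w i.
    rewrite /w /a; have : 0 <= (q i)%:R / (grid d)%:R :> R by rewrite divr_ge0 // ltW.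
    have : 0 <= (i == k)%:R :> R by [].
    nra.
  exists (\prod_i w i)^-1; first by rewrite invf_lt1 // (lt_trans _ pt).
  move=> V _; exists (fun i => V k + (w i)^-1 *: (V i - V k)) => [|l l0 l1 lq].
    rewrite (shrink_det V wk) => [|i]; last by rewrite gt_eqF.
    have p0 : 0 < \prod_i w i by rewrite (lt_trans _ pt).
    by rewrite normrM (gtr0_norm p0) mulrA mulVf ?mul1r // gt_eqF.
  apply: shrink_simplex => //.
  rewrite /w /a.
  have -> : \sum_i l i * (1 + t * ((q i)%:R / (grid d)%:R - 1 + (i == k)%:R))
      = (1 - t) * \sum_i l i + t / (grid d)%:R * (\sum_i l i * (q i)%:R) + t * l k.
    rewrite !mulr_sumr -!big_split /= [t * l k](_ : _ = \sum_i t * l i * (i == k)%:R).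
      by rewrite -big_split; apply: eq_bigr => i _ /=; field.
    rewrite (bigD1 k) //= eqxx mulr1 big1 ?addr0 // => i /negbTE ->.
    by rewrite mulr0.
  rewrite l1 mulr1.
  have : t / (grid d)%:R * \sum_i l i * (q i)%:R <= t.
    by rewrite mulrAC ler_pdivrMr // ler_pM2l.
  have := l0 k; nra.
move=> r r01 H; exists r => // q k V pc; exact: (H (q, k)).
Qed.

(* With [b i = a (V i - z) / m + 1], where [z] is the centroid and [-m] the
   minimum of [a (V i - z)], the code is [q i = floor (grid * b i)]. *)
Lemma centroid_cut d (V : 'I_d.+1 -> 'cV[R]_d) (a : 'rV[R]_d) :
  exists q : cut_code d, forall l : 'I_d.+1 -> R,
    (forall i, 0 <= l i) -> \sum_i l i = 1 ->
    dot a (\sum_i l i *: V i) < dot a ((d.+1%:R)^-1 *: \sum_i V i) ->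
    exists2 k, proper_cut q k & \sum_i l i * (q i)%:R <= (grid d)%:R.
Proof.
set z := _ *: _; pose al i := dot a (V i) - dot a z.
have d0 : 0 < d.+1%:R :> R by rewrite ltr0n.
have s0 : \sum_i al i = 0.
  rewrite sumrB sumr_const card_ord /z dotZr dot_sumr -mulrnAr -[X in _^-1 * X]mulr_natl.
  by rewrite mulKf ?subrr // gt_eqF.
have dotl (l : 'I_d.+1 -> R) : \sum_i l i = 1 ->
    dot a (\sum_i l i *: V i) - dot a z = \sum_i l i * al i.
  move=> l1; rewrite dot_sumr -[dot a z]mul1r -l1 mulr_suml -sumrB.
  by apply: eq_bigr => i _; rewrite dotZr mulrBr.
pose k := [arg min_(i < (ord0 : 'I_d.+1)) al i]%O.
have kP i : al k <= al i by rewrite /k; case: arg_minP => // j _; apply.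
(* If no vertex lies below the centroid, no point of the simplex satisfies the strict inequality and
   any code will do. *)
have [k0|k0] := leP 0 (al k).
  exists [ffun => ord0] => l l0 l1.
  rewrite -subr_lt0 dotl // ltNge sumr_ge0 // => i _.
  by rewrite mulr_ge0 // (le_trans k0).
pose b i := al i / - al k + 1.
have kn0 : al k != 0 by rewrite lt_eqF.
have b0 i : 0 <= b i.
  have ki := kP i; have mk0 : 0 < - al k by lra.
  by rewrite -(pmulr_rge0 _ mk0) /b mulrDr mulrCA divff ?gt_eqF //; lra.
have sb : \sum_i b i = d.+1%:R.
  by rewrite big_split /= -mulr_suml s0 mul0r add0r sumr_const card_ord.
have bk : b k = 0 by rewrite /b; field.
have bd i : b i <= d.+1%:R by rewrite -sb (bigD1 i) //= lerDl sumr_ge0.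
have qlt i : (Num.truncn ((grid d)%:R * b i) < (grid d * d.+1).+1)%N.
  rewrite ltnS -(ler_nat R); apply: (@le_trans _ _ ((grid d)%:R * b i)).
    by rewrite truncn_le mulr_ge0.
  by rewrite natrM ler_wpM2l.
exists [ffun i => Ordinal (qlt i)] => l l0 l1.
rewrite -subr_lt0 dotl // => lt.
exists k.
  split; first by rewrite ffunE /= bk mulr0 truncn0.
  rewrite -(ler_nat R) natr_sum.
  have : \sum_i ((grid d)%:R * b i - 1) <= \sum_i ([ffun i => Ordinal (qlt i)] i)%:R :> R.
    by apply: ler_sum => i _; rewrite ffunE /= lerBlDr natr1 ltW // truncnS_gt.
  move=> H; apply: le_trans H; rewrite sumrB -mulr_sumr sb sumr_const card_ord -natrM lerBrDr -natrD ler_nat.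
  by rewrite -mulSnr prednK.
apply: (@le_trans _ _ (\sum_i l i * ((grid d)%:R * b i))).
  by apply: ler_sum => i _; rewrite ffunE ler_wpM2l // truncn_le mulr_ge0.
have -> : \sum_i l i * ((grid d)%:R * b i)
   = (grid d)%:R * ((\sum_i l i * al i) / - al k + \sum_i l i).
  by rewrite mulr_suml -big_split mulr_sumr; apply: eq_bigr => i _ /=; rewrite /b; ring.
rewrite l1 -[leRHS]mulr1 ler_wpM2l // gerDr.
by rewrite ler_pdivrMr; lra.
Qed.

End Cuts.

(** * The number of queries, by induction on the dimension *)

Section SearchBound.
Variable R : realType.

(** Each query is the centroid and the answer is the code of a cut through it, until the determinant
    is below [theta] and [base] takes over. In this phase the letters of [J] retain nothing. *)
Lemma searchable_simplex d : exists2 r : R, 0 < r < 1 &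
  forall (J : finType) (j0 : J) n0 (theta : R) (G : 'cV[R]_d -> Prop),
  (forall V, `|\det (hom_mx V)| < theta ->
     searchable (J + cut_code d)%type n0 (fun x => G x /\ in_simplex V x)) ->
  forall n V, r ^+ n * `|\det (hom_mx V)| < theta ->
    searchable (J + cut_code d)%type (n + n0) (fun x => G x /\ in_simplex V x).
Proof.
have [r r01 HV] := proper_cut_shrinks R d; exists r => // J j0 n0 theta G base.
have [r0 r1] := andP r01.
elim=> [|n IH] V; first by rewrite expr0 mul1r => /base.
move=> ltV; rewrite addSn /=.
exists ((d.+1%:R)^-1 *: \sum_i V i).
exists (fun j x => if j is inr q then G x /\ (exists k, proper_cut q k) /\
   exists l, [/\ forall i, 0 <= l i, \sum_i l i = 1, x = \sum_i l i *: V i &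
               \sum_i l i * (q i)%:R <= (grid d)%:R] else False); split=> [[j|q]|a].
- by apply: (searchable0 (inl j0)) => x [].
- have [[k pq]|npq] := pselect (exists k, proper_cut q k); last first.
    by apply: (searchable0 (inl j0)) => x [_ [/npq]].
  have [V' leV' sV'] := HV q k V pq.
  apply: searchable_sub (IH V' _) => [x [Gx [_ [l [l0 l1 xE lq]]]]|].
    by split=> //; rewrite xE; apply: sV'.
  by apply: le_lt_trans ltV; rewrite exprSr -mulrA ler_pM2l // exprn_gt0.
have [q qP] := centroid_cut V a; exists (inr q) => x [Gx [l [l0 l1 xE]]].
rewrite xE => /(qP l l0 l1)[k pq lq]; rewrite -xE; split=> //.
by split; [exists k|exists l].
Qed.

Lemma half_power (r : R) : 0 < r < 1 -> exists n, r ^+ n <= 2^-1.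
Proof.
move=> /andP[r0 r1].
(* A form of Bernoulli's inequality; once [n%:R * (1 - r) > 1] it gives [2 * r ^+ n < 1]. *)
have bern n : r ^+ n * (1 + n%:R * (1 - r)) <= 1.
  elim: n => [|n IH]; first by rewrite mul0r addr0 mulr1.
  apply: le_trans IH; rewrite exprSr -mulrA ler_pM2l ?exprn_gt0 // -natr1.
  have n0 : 0 <= n%:R :> R by [].
  have : 0 <= n%:R * (1 - r) ^+ 2 by rewrite mulr_ge0 ?sqr_ge0.
  have : 0 <= (1 - r) ^+ 2 by rewrite sqr_ge0.
  rewrite !expr2; lra.
have e0 : 0 < 1 - r by lra.
have := archi_boundP (ltW (_ : 0 < (1 - r)^-1)); rewrite invr_gt0 => /(_ e0).
set n := Num.bound _ => nP; exists n; have := bern n.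
have : 1 < n%:R * (1 - r) by rewrite -ltr_pdivrMr // div1r.
have : 0 < r ^+ n by rewrite exprn_gt0.
nra.
Qed.

Lemma height_le_row' d b k (x : 'cV[R]_d.+1) : height_le b x -> height_le b (row' k x).
Proof.
move=> [q [p [q0 qb pP]]]; exists q, (fun j => p (lift k j)); split=> // j.
by rewrite mxE; exact: pP.
Qed.

Lemma height_le_bound d b (x : 'cV[R]_d) i : height_le b x -> `|x i 0| <= 2 ^+ b.
Proof.
move=> [q [p [q0 _ /(_ i)[pb xE]]]].
have q1 : 1 <= q%:~R :> R by rewrite ler1z -gtz0_ge1.
apply: (@le_trans _ _ (`|x i 0| * q%:~R)); first by rewrite ler_peMr.
rewrite -{1}(gtr0_norm (lt_le_trans ltr01 q1)) -normrM xE -intr_norm.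
have -> : 2 ^+ b = (2 ^+ b : int)%:~R :> R by rewrite rmorphXn.
by rewrite ler_int.
Qed.

(** Solve the equation for a coordinate [k] with nonzero coefficient; the point [x0] rules out an
    equation with a constant term only. The parameters are the other coordinates of [x], so the
    height bound is inherited. *)
Lemma hyperplane_section d (h : 'cV[R]_(1 + d.+1)) x0 : h != 0 -> hvec x0 *m h = 0 ->
  exists k (G : 'M[R]_(d.+1, d)) g, forall x : 'cV[R]_d.+1,
    hvec x *m h = 0 -> x = G *m row' k x + g.
Proof.
move=> h0 hx0.
have hE (x : 'cV[R]_d.+1) : hvec x *m h = 0 ->
    h (lshift _ ord0) 0 + \sum_j x j 0 * h (rshift 1 j) 0 = 0.
  move/matrixP/(_ 0 0); rewrite !mxE big_split_ord /= big_ord1 row_mxEl mxE mul1r => E.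
  by apply: etrans E; congr (_ + _); apply: eq_bigr => j _; rewrite row_mxEr mxE.
have [k hk] : exists k, h (rshift 1 k) 0 != 0.
  apply: contrapT => nk.
  have h1 : forall j, h (rshift 1 j) 0 = 0.
    by move=> j; apply/eqP; apply: contrapT => /negP nz; apply: nk; exists j.
  have := hE _ hx0; rewrite big1 => [|j _]; last by rewrite h1 mulr0.
  rewrite addr0 => h00; case/eqP: h0; apply/colP => i; rewrite mxE.
  by case: (split_ordP i) => j -> //; rewrite (ord1 j).
pose G : 'M[R]_(d.+1, d) := \matrix_(i, j)
  if unlift k i is Some i' then (i' == j)%:R else - h (rshift 1 (lift k j)) 0 / h (rshift 1 k) 0.
pose g : 'cV[R]_d.+1 := \col_i if i == k then - h (lshift _ ord0) 0 / h (rshift 1 k) 0 else 0.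
exists k, G, g => x /hE hx; apply/colP => i; rewrite mxE [g _ _]mxE mxE.
case: (unliftP k i) => [j ->|->].
  rewrite eq_sym (negbTE (neq_lift _ _)) addr0 (bigD1 j) //= !mxE liftK eqxx mul1r.
  by rewrite big1 ?addr0 // => j' /negbTE nj; rewrite mxE liftK eq_sym nj mul0r.
rewrite eqxx; move: hx; rewrite (bigD1_ord k) //= => hx.
have -> : \sum_j G k j * row' k x j 0 =
    - (\sum_j x (lift k j) 0 * h (rshift 1 (lift k j)) 0) / h (rshift 1 k) 0.
  rewrite -sumrN mulr_suml; apply: eq_bigr => j _; rewrite !mxE unlift_none.
  by rewrite !mulNr mulrAC [_ * h _ _]mulrC.
apply: (mulIf hk); rewrite mulrDl !divfK //; move: hx; set S := \sum_(j < d) _; lra.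
Qed.

Theorem search_bound d : exists (J : finType) (C : nat), inhabited J /\
  forall b (W : 'cV[R]_d -> Prop),
    (forall x, W x -> height_le b x) -> searchable J (C * b.+1) W.
Proof.
elim: d => [|d [J [C [[j0] IH]]]].
  exists unit, 1%N; split=> // b W _; rewrite mul1n /=.
  (* In dimension 0 all points are equal, so no strict cut exists. *)
  exists 0, (fun _ _ => False); split=> [j|a]; first by apply: (searchable0 tt) => x [].
  by exists tt => x _; rewrite (flatmx0 x) ltxx.
have [r r01 Hr] := searchable_simplex d.+1.
have [r0 r1] := andP r01; have [m rm] := half_power r01.
(* [D] counts vertices, [m] queries halve the determinant, and [F * 2 ^ (2 * b * D)] bounds the
   ratio of the initial determinant to [theta]. *)
pose D := d.+2; pose F := (D`! * D`! * d.+1.*2 ^ D)%N.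
exists (J + cut_code d.+1)%type, (m * (F + 2 * D) + C)%N.
split=> [|b W Wb]; first by split; left.
(* The factorial pays for the one in [det_in_simplex]: candidates in a simplex below [theta] have a
   determinant below [2 ^- (b * D)], hence 0 by [det_height]. *)
pose theta : R := (D`!%:R * 2 ^+ (b * D))^-1.
have Df0 : 0 < D`!%:R :> R by rewrite ltr0n fact_gt0.
have Db0 : 0 < 2 ^+ (b * D) :> R by rewrite exprn_gt0.
have [V0 boxV0 detV0] := simplex_box R b (ltn0Sn d).
have base V : `|\det (hom_mx V)| < theta ->
  searchable (J + cut_code d.+1)%type (C * b.+1) (fun x => W x /\ in_simplex V x).
  move=> ltV; pose A (v : 'rV[R]_(1 + d.+1)) := exists x, (W x /\ in_simplex V x) /\ v = hvec x.
  case: (spanning_or_hyperplane A) => [[h h0 hA]|[M AM uM]]; last first.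
    have [P PP] := choice AM.
    have MP : M = hom_mx P by apply/row_matrixP=> i; rewrite rowK; case: (PP i).
    have := det_height (fun i => Wb _ (PP i).1.1); rewrite -MP -unitfE -unitmxE uM => /(_ isT).
    have := det_in_simplex (fun i => (PP i).1.2); rewrite -MP => le1 le2.
    have : `|\det M| < (2 ^+ (b * D))^-1.
      apply: le_lt_trans le1 _; rewrite -ltr_pdivlMl // -invfM //.
    by move=> lt; move: le2; rewrite leNgt -ltr_pdivlMr // div1r lt.
  have [[x0 Wx0]|nx] := pselect (exists x, W x /\ in_simplex V x); last first.
    by apply: (searchable0 (inl j0)) => x Wx; apply: nx; exists x.
  have [k [G [g xE]]] := hyperplane_section h0 (hA _ (ex_intro _ x0 (conj Wx0 erefl))).
  apply: (@searchable_inj _ J _ inl) => [x y [] //|].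
  apply: (@searchable_affine _ _ _ _ _ G g _ (height_le b)); last exact: IH.
  move=> x Wx; exists (row' k x); first exact: height_le_row' (Wb _ Wx.1).
  by apply: xE; apply: hA; exists x; split.
(* [K] halvings suffice because [F < 2 ^ F]. *)
pose K := (F + 2 * b * D)%N.
have : searchable (J + cut_code d.+1)%type (m * K + C * b.+1) W.
  have := @Hr J j0 _ _ W base (m * K) V0.
  move=> H; apply: searchable_sub (H _) => [x Wx|].
    by split=> //; apply: boxV0 => i; apply: height_le_bound (Wb _ Wx).
  have rK : r ^+ (m * K) <= 2 ^- K.
    by rewrite exprM -exprVn lerXn2r // ?nnegrE ?invr_ge0 ?exprn_ge0 // ltW.
  apply: (@le_lt_trans _ _ (2 ^- K * (D`!%:R * (d.+1.*2%:R * 2 ^+ b) ^+ D))).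
    by apply: ler_pM => //; rewrite exprn_ge0 // ltW.
  rewrite ltr_pdivrMl ?exprn_gt0 // /theta ltr_pdivlMr ?mulr_gt0 //.
  have -> : D`!%:R * (d.+1.*2%:R * 2 ^+ b) ^+ D * (D`!%:R * 2 ^+ (b * D)) =
     F%:R * 2 ^+ (2 * b * D) :> R.
    have E : (2 * b * D = b * D + b * D)%N by rewrite -mulnA mul2n addnn.
    by rewrite /F natrM natrX natrM exprMn -exprM E exprD; ring.
  rewrite /K exprD ltr_pM2r ?exprn_gt0 // -natrX ltr_nat.
  exact: ltn_expl.
apply: searchable_leq; first by left.
rewrite mulnDl leq_add2r -mulnA leq_mul2l; apply/orP; right.
rewrite /K mulnDl; apply: leq_add; first by rewrite leq_pmulr.
by rewrite mulnAC leq_mul2l leqnSn orbT.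
Qed.

End SearchBound.

(** * Vertices of linear programs *)

Section LPVertex.
Variable R : realType.

(** Among the feasible points at least as good as [x], take one with the most tight rows. If these
    did not span, some [r] would be orthogonal to all of them, and moving along [r] or [- r] without
    loss would make another row tight. *)
Lemma pointed_lp_vertex (F : finType) d (a : F -> 'rV[R]_d) (be : F -> R) (c : 'rV[R]_d) x :
  (forall r, (forall k, dot (a k) r = 0) -> r = 0) ->
  (forall r, (forall k, dot (a k) r <= 0) -> dot c r <= 0) ->
  (forall k, dot (a k) x <= be k) ->
  exists y, [/\ forall k, dot (a k) y <= be k, dot c x <= dot c y &
    exists2 k : 'I_d -> F, forall i, dot (a (k i)) y = be (k i) &
      (\matrix_i a (k i)) \in unitmx].
Proof.
move=> pointed norec fx.
pose tight y := [set k | dot (a k) y == be k]%SET.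
pose Q n := exists y, [/\ forall k, dot (a k) y <= be k, dot c x <= dot c y & #|tight y| = n].
have Q0 : exists n, `[< Q n >] by exists #|tight x|; apply/asboolP; exists x.
have Qle n : `[< Q n >] -> (n <= #|F|)%N by move=> /asboolP[y [_ _ <-]]; exact: max_card.
case: (ex_maxnP Q0 Qle) => n /asboolP[y [fy cy ty]] maxn.
exists y; split=> //.
(* The ratio test: the move stops at the first row that becomes tight, while the rows already tight
   stay so. *)
have key r : (forall k, k \in tight y -> dot (a k) r = 0) -> 0 <= dot c r ->
    (exists k, 0 < dot (a k) r) -> False.
  move=> r0 cr [k0 ak0].
  pose ratio k := (be k - dot (a k) y) / dot (a k) r.
  have [k ak kmin] := @arg_minP _ _ F k0 (fun k => 0 < dot (a k) r) ratio ak0.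
  have t0 : 0 <= ratio k by rewrite divr_ge0 ?subr_ge0 // ltW.
  pose y' := y + ratio k *: r.
  have dy' k' : dot (a k') y' = dot (a k') y + ratio k * dot (a k') r.
    by rewrite /y' dotDr dotZr.
  have : `[< Q #|tight y'| >].
    apply/asboolP; exists y'; split=> // [k'|]; last first.
      by rewrite /y' dotDr dotZr (le_trans cy) // lerDl mulr_ge0.
    rewrite dy'; have [le0|gt0] := leP (dot (a k') r) 0.
      by rewrite (le_trans _ (fy k')) // gerDl mulr_ge0_le0.
    by have := kmin k' gt0; rewrite {2}/ratio ler_pdivlMr // -lerBrDl.
  move/maxn; rewrite -ty leqNgt => /negP; apply; apply: proper_card.
  apply/properP; split.
    apply/fintype.subsetP=> k' tk'; have := tk'; rewrite !inE dy' (r0 _ tk') mulr0 addr0 //.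
  exists k; first by rewrite inE dy' /ratio (divfK (lt0r_neq0 ak)) addrC subrK.
  by apply/negP => /r0 E; rewrite E ltxx in ak.
pose A v := exists k, k \in tight y /\ v = a k.
case: (spanning_or_hyperplane A) => [[r rn0 rA]|[M AM uM]]; last first.
  have [k kP] := choice AM; exists k => [i|].
    by have [] := kP i; rewrite inE => /eqP.
  rewrite (_ : matrix_of_fun _ _ = M) //; apply/row_matrixP=> i; rewrite rowK.
  by have [] := kP i.
have r0 k : k \in tight y -> dot (a k) r = 0.
  by move=> tk; rewrite /dot rA ?mxE //; exists k.
have rN0 k : k \in tight y -> dot (a k) (- r) = 0.
  by move=> tk; rewrite dotNr r0 ?oppr0.
have pos s : 0 < dot c s -> exists k, 0 < dot (a k) s.
  move=> cs; apply: contrapT => nk; have : dot c s <= 0.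
    apply: norec => k; rewrite leNgt; apply/negP => lt; apply: nk; by exists k.
  by rewrite leNgt cs.
(* If the objective varies along [r], [norec] supplies a row stopping the improving direction; if
   not, [pointed] supplies a row that varies along [r], and its sign picks the direction. *)
exfalso; have [cr|cr|cr] := ltgtP (dot c r) 0.
- apply: (key (- r)) => //; first by rewrite dotNr; lra.
  by apply: pos; rewrite dotNr; lra.
- by apply: (key r) => //; [lra|apply: pos].
have [k ak] : exists k, dot (a k) r != 0.
  apply: contrapT => nk; case/eqP: rn0; apply: pointed => k; apply/eqP.
  by apply: contrapT => /negP nz; apply: nk; exists k.
have [lt|gt|E] := ltgtP (dot (a k) r) 0.
- apply: (key (- r)) => //; first by rewrite dotNr cr oppr0.
  by exists k; rewrite dotNr; lra.
- by apply: (key r) => //; [rewrite cr|exists k].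
by rewrite E eqxx in ak.
Qed.

(** Makes room for the determinant bound d! 2^(L d), with d! estimated by 2^(d!). *)
Definition vertex_bits d L := (L * (d + d`!))%N.

Lemma adj_mul_le d L (N : 'M[int]_d) (b : 'cV[int]_d) i :
  (forall i j, `|N i j| < 2 ^+ L) -> (forall i, `|b i 0| < 2 ^+ L) ->
  `|(\adj N *m b) i 0| <= d`!%:R * (2 ^+ L) ^+ d.
Proof.
case: d N b i => [|d] N b i Nb bb; first by case: i.
rewrite mxE; apply: le_trans (ler_norm_sum _ _ _) _.
apply: (@le_trans _ _ (\sum_(j < d.+1) (d`!%:R * (2 ^+ L) ^+ d) * 2 ^+ L)).
  apply: ler_sum => j _; rewrite normrM; apply: ler_pM => //; last by rewrite ltW.
  rewrite mxE /cofactor normrM normrX normrN1 expr1n mul1r.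
  apply: det_le => [|i' j']; first by rewrite exprn_ge0.
  by rewrite !mxE ltW.
by rewrite sumr_const card_ord -mulrA -exprSr -mulrnAl -[_ *+ d.+1]mulr_natl -natrM.
Qed.

(** Cramer's rule, with [|\det N|] as the common denominator; the sign goes to the numerators. *)
Lemma cramer_height d L (N : 'M[int]_d) (b : 'cV[int]_d) (y : 'cV[R]_d) :
  (0 < L)%N -> (forall i j, `|N i j| < 2 ^+ L) -> (forall i, `|b i 0| < 2 ^+ L) ->
  \det N != 0 -> map_mx intr N *m y = map_mx intr b -> height_le (vertex_bits d L) y.
Proof.
move=> L0 Nb bb N0 Ny.
have bound : d`!%:R * (2 ^+ L) ^+ d <= 2 ^+ vertex_bits d L :> int.
  rewrite -exprM /vertex_bits mulnDr exprD mulrC ler_wpM2l ?exprn_ge0 //.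
  rewrite -natrX ler_nat (leq_trans (ltnW (ltn_expl _ (ltnSn 1)))) //.
  by rewrite leq_exp2l // leq_pmull.
pose p := \adj N *m b.
have yE i : y i 0 * (\det N)%:~R = (p i 0)%:~R.
  have : map_mx intr (\adj N) *m (map_mx intr N *m y) = map_mx intr p.
    by rewrite Ny -map_mxM.
  rewrite mulmxA -map_mxM mul_adj_mx map_scalar_mx mul_scalar_mx => /colP/(_ i).
  by rewrite !mxE mulrC.
exists `|\det N|, (fun i => Num.sg (\det N) * p i 0); split=> [||i].
- by rewrite normr_gt0.
- apply: le_trans bound; apply: det_le => [|i j]; first by rewrite exprn_ge0.
  by rewrite ltW.
split.
  rewrite normrM normr_sg N0 mul1r; apply: le_trans bound.
  exact: adj_mul_le.
by rewrite normrEsg !rmorphM /= mulrCA yE.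
Qed.

(** The point is a vertex of the polyhedron cut down to an orthant. The added rows have entries 0, 1
    and -1, so Cramer's rule keeps its bound, and they can only shrink the recession cone. *)
Lemma basic_solution (F : finType) d L (a : F -> 'rV[int]_d) (be : F -> int)
    (c : 'rV[R]_d) (x : 'cV[R]_d) :
  (0 < L)%N -> (forall k j, `|a k 0 j| < 2 ^+ L) -> (forall k, `|be k| < 2 ^+ L) ->
  (forall r, (forall k, dot (map_mx intr (a k)) r <= 0) -> dot c r <= 0) ->
  (forall k, dot (map_mx intr (a k)) x <= (be k)%:~R) ->
  exists y, [/\ forall k, dot (map_mx intr (a k)) y <= (be k)%:~R,
    dot c x <= dot c y & height_le (vertex_bits d L) y].
Proof.
move=> L0 ab bb norec fx.
have L1 : 1 < 2 ^+ L :> int by rewrite exprn_egt1 // -lt0n.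
(* Constraints of an orthant containing [x] make the polyhedron pointed. *)
pose s j : int := if 0 <= x j 0 then -1 else 1.
pose a' (k : F + 'I_d) : 'rV[int]_d :=
  match k with inl k => a k | inr j => s j *: delta_mx 0 j end.
pose be' (k : F + 'I_d) : int := match k with inl k => be k | inr j => 0 end.
have dots j (r : 'cV[R]_d) : dot (map_mx intr (a' (inr j))) r = (s j)%:~R * r j 0.
  rewrite dotE (bigD1 j) //= !mxE !eqxx /= mulr1 big1 ?addr0 // => i /negbTE ij.
  by rewrite !mxE ij andbF mulr0 mul0r.
have [||k|y [fy cy [k ky uk]]] := @pointed_lp_vertex _ d (fun k => map_mx intr (a' k))
    (fun k => (be' k)%:~R) c x.
- move=> r r0; apply/colP=> j; have := r0 (inr j); rewrite dots mxE.
  by move/eqP; rewrite mulf_eq0 intr_eq0 /s; case: ifP => _ /= /eqP.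
- by move=> r rk; apply: norec => k; exact: (rk (inl k)).
- case: k => [k|j]; first exact: fx.
  rewrite dots /s; case: (leP 0 (x j 0)) => x0; first by rewrite mulN1r oppr_le0.
  by rewrite mul1r ltW.
exists y; split=> // [k'|]; first exact: (fy (inl k')).
pose N := \matrix_i a' (k i).
have NE : \matrix_i map_mx intr (a' (k i)) = map_mx intr N :> 'M[R]_d.
  by apply/matrixP=> i j; rewrite !mxE.
apply: (@cramer_height _ _ N (\col_i be' (k i))) => //.
- move=> i j; rewrite mxE; case: (k i) => [k'|j'] //=.
  rewrite !mxE eqxx /= /s; case: ifP => _; rewrite ?mulN1r ?mul1r ?normrN;
  by case: (_ == _); rewrite ?normr0 ?normr1 ?exprn_gt0.
- by move=> i; rewrite mxE; case: (k i) => //= _; rewrite normr0 exprn_gt0.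
- by move: uk; rewrite NE unitmxE unitfE det_map_mx intr_eq0.
apply/colP=> i; rewrite mxE [RHS]mxE mxE -ky /dot !mxE.
by apply: eq_bigr => j _; rewrite !mxE.
Qed.

End LPVertex.

(** * Round protocols in the coordinator model *)

Local Open Scope nat_scope.

Section CoordinatorSteps.
Variables (s : nat) (X Y O : Type) (P : coord_protocol s X Y O).
Variables (x : 'I_s -> X) (y : Y).

Lemma coord_run_stop h n a : coord_next P y h = inr a -> coord_run_from P x y h n = Some a.
Proof. by case: n => [|n] /= ->. Qed.

Lemma coord_run_step h n i : coord_next P y h = inl i ->
  coord_run_from P x y h n.+1 = coord_run_from P x y
    (fun j => if j == i then rcons (h i) (coord_new_bit P x y h i) else h j) n.
Proof. by move=> /= ->. Qed.

End CoordinatorSteps.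

(* In every round each server sends a letter of [A] and then receives the
   letter of [B] that the coordinator broadcasts. *)
Record round_protocol (s : nat) (X Y O : Type) (A B : finType) := RoundProtocol {
  server_msg : X -> seq B -> A;
  coord_msg : Y -> seq {ffun 'I_s -> A} -> B;
  round_output : Y -> seq {ffun 'I_s -> A} -> O }.

Section Rounds.
Variables (s : nat) (X Y O : Type) (A B : finType) (P : round_protocol s X Y O A B).
Variables (x : 'I_s -> X) (y : Y).

Fixpoint rounds (t : nat) : seq {ffun 'I_s -> A} * seq B :=
  if t is t'.+1 then
    let ms := rcons (rounds t').1 [ffun i => server_msg P (x i) (rounds t').2] in
    (ms, rcons (rounds t').2 (coord_msg P y ms))
  else ([::], [::]).

Definition round_msgs t := [ffun i => server_msg P (x i) (rounds t).2].
Definition round_bcast t := coord_msg P y (rounds t.+1).1.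

Lemma roundsE t : rounds t = (mkseq round_msgs t, mkseq round_bcast t).
Proof.
elim: t => [//|t IH]; have [E1 E2] := (congr1 fst IH, congr1 snd IH).
by rewrite !mkseqS -[mkseq round_msgs t]E1 -[mkseq round_bcast t]E2.
Qed.

End Rounds.

(** * Compiling rounds into single bits on the channels *)

Section OneHot.
Variables (T : finType) (t0 : T).

(** Indicator sequences give every letter the same length [#|T|], a constant for the alphabets in
    use. *)
Definition onehot (a : T) (q : nat) : bool := q == enum_rank a :> nat.
Definition onehot_inv (f : nat -> bool) : T := odflt t0 [pick a | f (enum_rank a)].

Lemma onehotK (a : T) f : (forall q, q < #|T| -> f q = onehot a q) -> onehot_inv f = a.
Proof.
move=> fa; rewrite /onehot_inv; case: pickP => [b|/(_ a)] /=.
  by rewrite fa // /onehot (inj_eq val_inj) (inj_eq enum_rank_inj) => /eqP.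
by rewrite fa // /onehot eqxx.
Qed.

End OneHot.

Section Compile.
Variables (s' : nat) (X Y O : Type) (A B : finType) (a0 : A) (b0 : B).
Let s := s'.+1.
Variables (P : round_protocol s X Y O A B) (T : nat).

Let len := #|A| + #|B|.

Let A_gt0 : 0 < #|A|. Proof. by apply/card_gt0P; exists a0. Qed.
Let len_gt0 : 0 < len. Proof. by rewrite addn_gt0 A_gt0. Qed.

Let readB (h : seq bool) t :=
  mkseq (fun t' => onehot_inv b0 (fun q => nth false h (t' * len + (#|A| + q)))) t.
Let readA (H : 'I_s -> seq bool) t :=
  mkseq (fun t' => [ffun i => onehot_inv a0 (fun q => nth false (H i) (t' * len + q))]) t.

(** Bits travel in rotation over the channels. A round takes [len] bits per channel, first the
    server's letter and then the broadcast, so the length of a channel tells whose turn it is. The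
    coordinator reads one round beyond the completed ones, since its letter answers the current
    messages. *)
Definition compiled_round_protocol : coord_protocol s X Y O := {|
  coord_next := fun y H =>
    if \sum_i size (H i) < s * (len * T) then inl (inord ((\sum_i size (H i)) %% s))
    else inr (round_output P y (readA H T));
  coord_bit := fun y H i => onehot (coord_msg P y (readA H (size (H i) %/ len).+1))
    (size (H i) %% len - #|A|);
  channel_turn := fun _ h => size h %% len < #|A|;
  server_bit := fun _ x h => onehot (server_msg P x (readB h (size h %/ len))) (size h %% len)
|}.

Variables (x : 'I_s -> X) (y : Y).

(** The intended bit at position [p] of channel [i]; [cnt n i] below counts the bits there after [n]
    steps of the rotation. *)
Let bit i p := if p %% len < #|A| then onehot (round_msgs P x y (p %/ len) i) (p %% len)
  else onehot (round_bcast P x y (p %/ len)) (p %% len - #|A|).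

Let cnt n (i : nat) := n %/ s + (i < n %% s).

Let cntS n i : i < s -> cnt n.+1 i = if i == n %% s then (cnt n i).+1 else cnt n i.
Proof.
move=> lt_is; rewrite /cnt; have lt_r := ltn_pmod n (ltn0Sn s').
have E := divn_eq n s; set q := n %/ s in E *; set r := n %% s in E lt_r *.
have [lt1|ge1] := ltnP r.+1 s.
  have -> : n.+1 = q * s + r.+1 by rewrite addnS -E.
  rewrite divnMDl // modnMDl divn_small // modn_small // addn0.
  case: eqP => ir; lia.
have rs : r.+1 = s by apply/eqP; rewrite eqn_leq lt_r ge1.
have -> : n.+1 = q.+1 * s by rewrite mulSn addnC -{2}rs addnS -E.
rewrite mulnK // modnMl; case: eqP => ir; lia.
Qed.

Let cnt_sum n : \sum_(i < s) cnt n i = n.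
Proof.
rewrite big_split /= sum_nat_const card_ord mulnC.
have -> : \sum_(i < s) (i < n %% s) = n %% s.
  have lt := ltnW (ltn_pmod n (ltn0Sn s')); move: lt; set r := n %% _ => lt.
  transitivity (\sum_(i < r) 1); last by rewrite sum1_card card_ord.
  rewrite (big_ord_widen s (fun=> 1) lt).
  by rewrite [RHS]big_mkcond; apply: eq_bigr => i _; case: ifP.
by rewrite -divn_eq.
Qed.

Let H n : 'I_s -> seq bool := fun i => mkseq (bit i) (cnt n i).

Let readB_bits i p t : t * len <= p -> readB (mkseq (bit i) p) t = mkseq (round_bcast P x y) t.
Proof.
move=> tp; apply/eq_in_map => t'; rewrite mem_iota add0n => /andP[_ t't].
apply: onehotK => q qB.
have lt : #|A| + q < len by rewrite ltn_add2l.
have lt' : t' * len + (#|A| + q) < p.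
  apply: leq_trans tp; apply: (@leq_trans (t'.+1 * len)); last by rewrite leq_mul2r t't orbT.
  by rewrite mulSn addnC ltn_add2r.
by rewrite nth_mkseq // /bit modnMDl modn_small // divnMDl // divn_small // addn0 ltnNge leq_addr addKn.
Qed.

Let readA_bits n t : (forall t' i, t' < t -> t' * len + #|A| <= cnt n i) ->
  readA (H n) t = mkseq (round_msgs P x y) t.
Proof.
move=> tp; apply/eq_in_map => t'; rewrite mem_iota add0n => /andP[_ t't].
apply/ffunP=> i; rewrite ffunE; apply: onehotK => q qA.
have lt : q < len by rewrite (leq_trans qA) ?leq_addr.
have lt' : t' * len + q < cnt n i by rewrite (leq_trans _ (tp _ _ t't)) // ltn_add2l.
by rewrite /H nth_mkseq // /bit modnMDl modn_small // divnMDl // divn_small // addn0 qA.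
Qed.

Let run n m : n + m = s * (len * T) ->
  coord_run_from compiled_round_protocol x y (H n) m =
  Some (round_output P y (rounds P x y T).1).
Proof.
have sumH k : \sum_i size (H k i) = k.
  by under eq_bigr do rewrite size_mkseq; exact: cnt_sum.
elim: m n => [|m IH] n nm.
  have stop : coord_next compiled_round_protocol y (H n) =
      inr (round_output P y (rounds P x y T).1).
    rewrite /= sumH -nm addn0 ltnn; congr (inr (round_output _ _ _)).
    rewrite readA_bits ?roundsE // => t' i t'T.
    rewrite addn0 in nm; rewrite nm /cnt mulKn // modnMr addn0.
    apply: (@leq_trans (t'.+1 * len)); last by rewrite mulnC leq_mul2l t'T orbT.
    by rewrite mulSn addnC leq_add2r leq_addr.
  exact: coord_run_stop.
pose i : 'I_s := inord (n %% s).
have iE : i = n %% s :> nat by rewrite inordK // ltn_pmod.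
have next : coord_next compiled_round_protocol y (H n) = inl i.
  by rewrite /= sumH -nm -addSnnS leq_addr.
rewrite (coord_run_step _ _ next) -(IH n.+1) ?addSnnS //.
congr coord_run_from; apply/funext => j; rewrite /H cntS // -iE.
case: (eqVneq j i) => [->|ji]; last by rewrite (_ : (j == i :> nat) = false) //; apply/negbTE.
rewrite eqxx mkseqS; congr rcons.
have cntE : cnt n i = n %/ s by rewrite /cnt iE ltnn addn0.
rewrite /coord_new_bit /= size_mkseq /bit; case: ifP => turn.
  by rewrite readB_bits ?leq_divM // /round_msgs ffunE roundsE //.
(* The rotation has put at least [n %/ s] bits on every channel, so at the coordinator's turn all
   messages of the current round are complete. *)
rewrite readA_bits => [|t' k].
  by rewrite /round_bcast roundsE.
rewrite ltnS cntE => t'n; apply: (@leq_trans (n %/ s)); last by rewrite leq_addr.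
rewrite [leqRHS](divn_eq _ len) leq_add //; first by rewrite leq_mul2r t'n orbT.
by rewrite leqNgt -cntE turn.
Qed.

Lemma compiled_round_run :
  coord_run compiled_round_protocol x y (s * (len * T)) =
  Some (round_output P y (rounds P x y T).1).
Proof.
rewrite -(@run 0 _ (add0n _)); congr coord_run_from; exact/funext.
Qed.

End Compile.

(** * From search to a protocol *)

Local Open Scope ring_scope.

Section Game.
Variables (R : realType) (d : nat) (J : finType) (j0 : J).

(** Choice fixes one strategy, which all parties can follow from the letters alone. *)
Lemma search_strategy : exists (query : nat -> ('cV[R]_d -> Prop) -> 'cV[R]_d)
    (kept : nat -> ('cV[R]_d -> Prop) -> J -> 'cV[R]_d -> Prop),
  forall n W, searchable J n.+1 W -> (forall j, searchable J n (kept n W j)) /\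
    forall a : 'rV[R]_d, exists j, forall x,
      W x -> dot a x < dot a (query n W) -> kept n W j x.
Proof.
have /choice[f fP] (nW : nat * ('cV[R]_d -> Prop)) : exists zW :
    'cV[R]_d * (J -> 'cV[R]_d -> Prop), searchable J nW.1.+1 nW.2 ->
    (forall j, searchable J nW.1 (zW.2 j)) /\
    forall a : 'rV[R]_d, exists j, forall x, nW.2 x -> dot a x < dot a zW.1 -> zW.2 j x.
  case: nW => n W; have [[z [W' H]]|nH] := pselect (searchable J n.+1 W).
    by exists (z, W').
  by exists (0, fun _ _ => False) => /nH.
exists (fun n W => (f (n, W)).1), (fun n W => (f (n, W)).2) => n W; exact: (fP (n, W)).
Qed.

Variables (query : nat -> ('cV[R]_d -> Prop) -> 'cV[R]_d)
  (kept : nat -> ('cV[R]_d -> Prop) -> J -> 'cV[R]_d -> Prop).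
Hypothesis strategyP : forall n W, searchable J n.+1 W ->
  (forall j, searchable J n (kept n W j)) /\
  forall a : 'rV[R]_d, exists j, forall x,
    W x -> dot a x < dot a (query n W) -> kept n W j x.

Fixpoint alive n (W : 'cV[R]_d -> Prop) (js : seq J) {struct js} : 'cV[R]_d -> Prop :=
  match js, n with j :: js', n'.+1 => alive n' (kept n' W j) js' | _, _ => W end.

Lemma alive_rcons n W js j : (size js < n)%N ->
  alive n W (rcons js j) = kept (n - (size js).+1) (alive n W js) j.
Proof.
elim: js n W => [|i js IH] [|n] W //=; first by rewrite subn1.
by rewrite ltnS subSS => /IH ->.
Qed.

Lemma searchable_alive n W js : (size js <= n)%N -> searchable J n W ->
  searchable J (n - size js) (alive n W js).
Proof.
elim: js n W => [|i js IH] [|n] W //= le_n sW.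
by rewrite subSS; apply: IH => //; have [/(_ i)] := strategyP sW.
Qed.

Definition separable (P : 'cV[R]_d -> Prop) : Prop :=
  forall z, ~ P z -> exists a : 'rV[R]_d, forall x, P x -> dot a x < dot a z.

Variables (T : nat) (W0 : 'cV[R]_d -> Prop).
Hypothesis W0_searchable : searchable J T W0.

Let asked js : 'cV[R]_d := query (T - (size js).+1) (alive T W0 js).

Variables (X Y : Type) (sfeas : X -> 'cV[R]_d -> Prop) (cfeas : Y -> 'cV[R]_d -> Prop)
  (obj : Y -> 'rV[R]_d).

(** Safety depends on the history and on one party's constraints, so a server can announce all its
    safe letters without knowing the rows of others. *)
Definition safe_cut (P : 'cV[R]_d -> Prop) (js : seq J) (j : J) : bool :=
  `[< forall x, alive T W0 js x -> P x -> alive T W0 (rcons js j) x >].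

Definition game_msg (x : X) (js : seq J) : {ffun J -> bool} :=
  [ffun j => safe_cut (sfeas x) js j].

Variable s : nat.

Definition game_state : Type := (seq J * option 'cV[R]_d)%type.

Definition better (y : Y) (best : option 'cV[R]_d) (z : 'cV[R]_d) : option 'cV[R]_d :=
  if best is Some w then if dot (obj y) w <= dot (obj y) z then Some z else Some w
  else Some z.

(** If no letter is safe for anybody, the queried point is feasible; it competes for the best point
    and the objective provides the cut. The default [j0] does not occur under the hypotheses of
    [game_inv_step]. *)
Definition game_step (y : Y) (st : game_state) (m : {ffun 'I_s -> {ffun J -> bool}}) :
    game_state :=
  let js := st.1 in
  match [pick j | [exists i, m i j] || safe_cut (cfeas y) js j] with
  | Some j => (rcons js j, st.2)
  | None =>
      let z := asked js in
      (rcons js (odflt j0 [pick j | safe_cut (fun x => dot (obj y) z < dot (obj y) x) js j]),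
       better y st.2 z)
  end.

Variables (x : 'I_s -> X) (y : Y).
Hypothesis sfeas_sep : forall i, separable (sfeas (x i)).
Hypothesis cfeas_sep : separable (cfeas y).

Definition game_feasible z : Prop := (forall i, sfeas (x i) z) /\ cfeas y z.

Definition game_inv (st : game_state) : Prop :=
  (forall w, st.2 = Some w -> game_feasible w) /\
  (forall z, W0 z -> game_feasible z ->
     alive T W0 st.1 z \/ exists2 w, st.2 = Some w & dot (obj y) z <= dot (obj y) w).

(** A queried point outside a separable set is cut off by some row, and the strategy turns this row
    into a safe letter. So without safe letters the point is feasible, and whatever the objective
    cut loses is no better than it. *)
Lemma game_inv_step st (m : {ffun 'I_s -> {ffun J -> bool}}) : (size st.1 < T)%N -> game_inv st ->
  (forall i, m i = game_msg (x i) st.1) -> game_inv (game_step y st m).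
Proof.
case: st => js best /= ltT [inv1 inv2] mE.
have sW : searchable J (T - (size js).+1).+1 (alive T W0 js).
  by rewrite subnSK //; apply: searchable_alive => //; apply: ltnW.
have [_ cuts] := strategyP sW.
have cutP (a : 'rV[R]_d) : exists j, forall x, alive T W0 js x ->
    dot a x < dot a (asked js) -> alive T W0 (rcons js j) x.
  by have [j jP] := cuts a; exists j => z; rewrite alive_rcons //; exact: jP.
have sepP (P : 'cV[R]_d -> Prop) : separable P -> (forall j, ~~ safe_cut P js j) -> P (asked js).
  move=> sP nsafe; apply: contrapT => /sP[a aP]; have [j jP] := cutP a.
  by case/asboolP: (nsafe j) => z az /aP; exact: jP.
rewrite /game_step /=; case: pickP => [j jP|none].
  split=> //= z Wz fz; have [az|?] := inv2 z Wz fz; [left|by right].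
  case/orP: jP => [/existsP[i]|/asboolP]; last by apply=> //; case: fz.
  by rewrite mE ffunE => /asboolP; apply=> //; case: fz.
have fz : game_feasible (asked js).
  split=> [i|]; apply: sepP => // j; have := none j; rewrite /= => /negbT.
    by rewrite negb_or => /andP[/existsPn/(_ i)]; rewrite mE ffunE.
  by rewrite negb_or => /andP[].
split=> /= [w|z Wz fez].
  rewrite /better; case: best {inv2} inv1 => [w'|] inv1; last by case=> <-.
  by case: ifP => _ [<-] //; apply: inv1.
have bz : exists2 w, better y best (asked js) = Some w &
    dot (obj y) (asked js) <= dot (obj y) w /\
    forall w', best = Some w' -> dot (obj y) w' <= dot (obj y) w.
  rewrite /better; case: (best) => [w'|]; last by exists (asked js).
  case: ifP => le; first by exists (asked js) => //; split=> // _ [<-].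
  exists w' => //; split=> [|_ [<-]//].
  by move/negbT: le; rewrite -ltNge => /ltW.
have [w bE [le1 le2]] := bz.
case: (inv2 z Wz fez) => [az|[w' /le2 le3 le4]]; last first.
  by right; exists w => //; apply: le_trans le4 le3.
have [le|gt] := leP (dot (obj y) z) (dot (obj y) (asked js)).
  by right; exists w => //; apply: le_trans le le1.
left; case: pickP => [j /asboolP|/= nj]; first exact.
(* Strictly better points lie below the query for the negated objective. *)
have [j jP] := cutP (- obj y); have /asboolP := nj j; case => z' az'.
by move=> lt; apply: jP => //; rewrite !dotNl ltrN2.
Qed.

Lemma game_inv_end st : size st.1 = T -> game_inv st ->
  (forall w, st.2 = Some w -> game_feasible w) /\
  (forall z, W0 z -> game_feasible z ->
     exists2 w, st.2 = Some w & dot (obj y) z <= dot (obj y) w).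
Proof.
move=> sT [inv1 inv2]; split=> // z Wz /(inv2 z Wz)[az|//].
have := searchable_alive (eq_leq sT) W0_searchable; rewrite sT subnn => /(_ z).
by move=> /(_ az).
Qed.

End Game.

(** * The linear program and its recession program as searches *)

Section LPProtocol.
Variables (R : realType) (d L s : nat).

Definition server_feasible (K : constraints d L) (x : 'cV[R]_d) : Prop :=
  forall k, dot (map_mx intr (row k (lhs K))) x <= (rhs K k 0)%:~R.

Definition server_recession (K : constraints d L) (r : 'cV[R]_d) : Prop :=
  forall k, dot (map_mx intr (row k (lhs K))) r <= 0.

Definition obj_row (c : objective d L) : 'rV[R]_d := (map_mx intr (obj_coef c))^T.

Lemma dot_row (K : constraints d L) k (x : 'cV[R]_d) :
  (map_mx intr (lhs K) *m x) k 0 = dot (map_mx intr (row k (lhs K))) x.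
Proof. by rewrite /dot map_row -row_mul [RHS]mxE. Qed.

Lemma feasibleE (K : 'I_s -> constraints d L) x :
  feasible K x <-> forall i, server_feasible (K i) x.
Proof. by split=> f i k; have := f i k; rewrite dot_row. Qed.

Lemma separable_halfspaces F (a : F -> 'rV[R]_d) (be : F -> R) :
  separable (fun x => forall k, dot (a k) x <= be k).
Proof.
move=> z nz; have [k ak] : exists k, be k < dot (a k) z.
  apply: contrapT => nk; apply: nz => k; rewrite leNgt; apply/negP => lt; apply: nk.
  by exists k.
by exists (a k) => x /(_ k) le; apply: le_lt_trans ak.
Qed.

Lemma separable_server_feasible K : separable (server_feasible K).
Proof. exact: separable_halfspaces. Qed.

Lemma separable_server_recession K : separable (server_recession K).
Proof. exact: (@separable_halfspaces _ _ (fun _ => 0)). Qed.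

Lemma separable_obj_le1 (c : objective d L) : separable (fun r => dot (obj_row c) r <= 1).
Proof.
move=> z nz; exists (obj_row c) => x le; apply: le_lt_trans le _.
by rewrite ltNge; apply/negP.
Qed.

Section Correct.
Variables (K : 'I_s -> constraints d L) (c : objective d L).
Hypothesis L_gt0 : (0 < L)%N.
Let c' := obj_row c.
Let W := @height_le R d (vertex_bits d L).
Let rec_feasible r := (forall i, server_recession (K i) r) /\ dot c' r <= 1.
Let lp_feasible x := (forall i, server_feasible (K i) x) /\ True.
Let row_index : finType := {i : 'I_s & 'I_(nrows (K i))}.

Lemma lp_basic_solution (c0 : 'rV[R]_d) x :
  (forall r, (forall i, server_recession (K i) r) -> dot c0 r <= 0) -> feasible K x ->
  exists y, [/\ W y, lp_feasible y & dot c0 x <= dot c0 y].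
Proof.
move=> norec /feasibleE fx.
have [||||y [fy cy hy]] := @basic_solution R row_index d L
  (fun ik => row (tagged ik) (lhs (K (tag ik)))) (fun ik => rhs (K (tag ik)) (tagged ik) 0) c0 x L_gt0.
- by move=> [i k] j; rewrite mxE; exact: lhs_bits.
- by move=> [i k]; exact: rhs_bits.
- by move=> r rr; apply: norec => i k; exact: (rr (Tagged _ k)).
- by move=> [i k]; exact: fx.
by exists y; split=> //; split=> // i k; exact: (fy (Tagged _ k)).
Qed.

(** The row [dot c' r <= 1] bounds the recession program, so if some ray improves the objective, one
    of bounded height does, and [r] reveals it. Otherwise every feasible point is dominated by a
    candidate and the best one is optimal. *)
Lemma lp_output_correct (r x : option 'cV[R]_d) :
  (forall z, r = Some z -> rec_feasible z) ->
  (forall z, W z -> rec_feasible z -> exists2 w, r = Some w & dot c' z <= dot c' w) ->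
  (forall z, x = Some z -> lp_feasible z) ->
  (forall z, W z -> lp_feasible z -> exists2 w, x = Some w & dot c' z <= dot c' w) ->
  lp_correct K c (match x with
    | Some x => if r is Some r then if 0 < dot c' r then Unbounded _ _ else Optimal x
                else Optimal x
    | None => Infeasible _ _ end).
Proof.
move=> r1 r2 x1 x2; case: x x1 x2 => [x|] x1 x2; last first.
  (* No ray improves the zero objective, so any feasible program has a feasible candidate. *)
  move=> z fz; have [|y [Wy fy _]] := @lp_basic_solution 0 z _ fz.
    by move=> r' _; rewrite /dot mul0mx mxE.
  by have [] := x2 y Wy fy.
have [fx _] := x1 x erefl.
have [cr|ncr] := pselect (exists2 q, (forall i, server_recession (K i) q) & 0 < dot c' q).
  have [q rq cq] := cr.
  have [w rw cw] : exists2 w, r = Some w & 0 < dot c' w.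
    (* Scaled to value 1, the ray is feasible for the recession program; [None] below indexes the
       row [dot c' r <= 1]. *)
    pose q' := (dot c' q)^-1 *: q.
    have cq' : dot c' q' = 1 by rewrite dotZr mulVf // gt_eqF.
    pose a (k : option row_index) : 'rV[int]_d :=
      if k is Some ik then row (tagged ik) (lhs (K (tag ik))) else (obj_coef c)^T.
    pose be (k : option row_index) : int := if k is Some _ then 0 else 1.
    have aNone : map_mx intr (a None) = c' by rewrite /c' /obj_row map_trmx.
    have L1 : 1 < 2 ^+ L :> int by rewrite exprn_egt1 // -lt0n.
    have [||||y [fy cy hy]] := @basic_solution R (option row_index) d L a be c' q' L_gt0.
    - by case=> [[i k]|] j; rewrite mxE; [exact: lhs_bits|exact: obj_bits].
    - by case=> [_|] /=; rewrite ?normr0 ?normr1 ?exprn_gt0.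
    - by move=> r' /(_ None); rewrite aNone.
    - case=> [[i k]|]; last by rewrite aNone cq'.
      rewrite dotZr; apply: mulr_ge0_le0; last exact: rq.
      by rewrite invr_ge0 ltW.
    have fy' : rec_feasible y.
      by split=> [i k|]; [exact: (fy (Some (Tagged _ k)))|have := fy None; rewrite aNone].
    have [w rw cw] := r2 y hy fy'; exists w => //.
    by apply: lt_le_trans cw; apply: lt_le_trans cy; rewrite cq'.
  rewrite rw cw => t.
  have [rw1 _] := r1 w rw.
  (* This step length raises the objective by [|t - dot c' x| + 1], hence above [t]. *)
  exists (x + (`|t - dot c' x| / dot c' w + (dot c' w)^-1) *: w).
    apply/feasibleE => i k; rewrite dotDr dotZr -[leRHS]addr0 lerD ?fx //.
    by rewrite mulr_ge0_le0 ?rw1 // addr_ge0 ?divr_ge0 ?invr_ge0 // ltW.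
  rewrite [ltRHS](_ : _ = dot c' x + `|t - dot c' x| + 1); last first.
    rewrite /obj_value -/(dot _ _) -/c' dotDr dotZr mulrDl divfK ?mulVf ?gt_eqF //.
    by rewrite addrA.
  by have := ler_norm (t - dot c' x); lra.
have opt : lp_correct K c (Optimal x).
  split; first by apply/feasibleE.
  move=> z fz; have [|y [Wy fy cy]] := @lp_basic_solution c' z _ fz.
    by move=> q rq; rewrite leNgt; apply/negP => cq; apply: ncr; exists q.
  have [w [<-] le] := x2 y Wy fy; exact: le_trans cy le.
case: r r1 {r2} => [w|//] r1; case: ifP => // cw.
by case: ncr; exists w => //; have [] := r1 w erefl.
Qed.
End Correct.
End LPProtocol.

Section LPSolvable.
Variables (R : realType) (d : nat) (J : finType) (j0 : J).
Variables (query : nat -> ('cV[R]_d -> Prop) -> 'cV[R]_d)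
  (kept : nat -> ('cV[R]_d -> Prop) -> J -> 'cV[R]_d -> Prop).
Hypothesis strategyP : forall n W, searchable J n.+1 W ->
  (forall j, searchable J n (kept n W j)) /\
  forall a : 'rV[R]_d, exists j, forall x,
    W x -> dot a x < dot a (query n W) -> kept n W j x.
Variables (L s T : nat).
Let W := @height_le R d (vertex_bits d L).
Hypothesis W_searchable : searchable J T W.

Let A : finType := ({ffun J -> bool} * {ffun J -> bool})%type.
Let B : finType := (J * J)%type.

Let rec_state (c : objective d L) (ms : seq {ffun 'I_s -> A}) :=
  foldl (fun st (m : {ffun 'I_s -> A}) => game_step j0 query kept T W (fun c r => dot (obj_row R c) r <= 1)
    (@obj_row R d L) c st [ffun i => (m i).1]) ([::], None) ms.
Let lp_state (c : objective d L) (ms : seq {ffun 'I_s -> A}) :=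
  foldl (fun st (m : {ffun 'I_s -> A}) => game_step j0 query kept T W (fun _ _ => True)
    (@obj_row R d L) c st [ffun i => (m i).2]) ([::], None) ms.

Variables (X Y : Type) (fX : X -> constraints d L) (fY : Y -> objective d L).

(* The linear program and its recession program [A r <= 0, c r <= 1] are
   searched in parallel. *)
Definition lp_rounds : round_protocol s X Y (lp_answer R d) A B := {|
  server_msg := fun K js =>
    (game_msg kept T W (@server_recession R d L) (fX K) (unzip1 js),
     game_msg kept T W (@server_feasible R d L) (fX K) (unzip2 js));
  coord_msg := fun c ms =>
    (last j0 (rec_state (fY c) ms).1, last j0 (lp_state (fY c) ms).1);
  round_output := fun c ms =>
    match (lp_state (fY c) ms).2, (rec_state (fY c) ms).2 with
    | None, _ => Infeasible R d
    | Some x, None => Optimal x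
    | Some x, Some r => if 0 < dot (obj_row R (fY c)) r then Unbounded R d else Optimal x
    end |}.

(** Each step appends one letter, so broadcasting the last one keeps the servers' history equal to
    the coordinator's. *)
Lemma game_step_last (Y' : Type) cf ob (y : Y') st (m : {ffun 'I_s -> {ffun J -> bool}}) :
  (game_step j0 query kept T W cf ob y st m).1 =
  rcons st.1 (last j0 (game_step j0 query kept T W cf ob y st m).1).
Proof. by rewrite /game_step; case: pickP => [j _|_] /=; rewrite last_rcons. Qed.

Lemma lp_rounds_correct (x : 'I_s -> X) (y : Y) : (0 < L)%N ->
  lp_correct (fun i => fX (x i)) (fY y)
    (round_output lp_rounds y (rounds lp_rounds x y T).1).
Proof.
move=> L0; set c := fY y; pose K i := fX (x i).
pose inv1 := game_inv kept T W (@server_recession R d L)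
  (fun c r => dot (obj_row R c) r <= 1) (@obj_row R d L) K c.
pose inv2 := game_inv kept T W (@server_feasible R d L) (fun _ _ => True) (@obj_row R d L) K c.
have inv t : (t <= T)%N ->
    let: (ms, js) := rounds lp_rounds x y t in
    [/\ (rec_state c ms).1 = unzip1 js /\ (lp_state c ms).1 = unzip2 js, size js = t,
      inv1 (rec_state c ms) & inv2 (lp_state c ms)].
  elim: t => [_|t IH ltT] /=.
    split=> //; first by split=> // z Wz _; left; case: (T).
    by split=> // z Wz _; left; case: (T).
  have := IH (ltnW ltT); case: (rounds _ _ _ t) => ms js /= [[e1 e2] sj i1 i2].
  rewrite /rec_state /lp_state !foldl_rcons -/(rec_state c ms) -/(lp_state c ms) /unzip1 /unzip2 !map_rcons size_rcons sj.
  split=> //.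
  - by split; rewrite ?map_rcons /= -?/(unzip1 js) -?/(unzip2 js) -?e1 -?e2 -game_step_last.
  - apply: game_inv_step => //; rewrite ?e1 ?size_map ?sj //.
    + by move=> i; apply: separable_server_recession.
    + exact: separable_obj_le1.
    + by move=> i; rewrite !ffunE.
  apply: game_inv_step => //; rewrite ?e2 ?size_map ?sj //.
  - by move=> i; apply: separable_server_feasible.
  - by move=> i; rewrite !ffunE.
have := inv T (leqnn T); case: (rounds _ _ _ T) => ms js /= [[e1 e2] sj i1 i2].
have [|r1 r2] := game_inv_end strategyP W_searchable _ i1; first by rewrite e1 size_map.
have [|x1 x2] := game_inv_end strategyP W_searchable _ i2; first by rewrite e2 size_map.
rewrite -/c; have := lp_output_correct L0 r1 r2 x1 x2.
by case: (lp_state c ms).2 => [z|] //; case: (rec_state c ms).2.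
Qed.

End LPSolvable.

Lemma succeeds_always s p m O (run : coins s p m -> option O) (good : O -> Prop) a :
  (forall w, run w = Some a) -> good a -> succeeds run good.
Proof.
move=> runE ga; split=> [w|]; first by rewrite runE.
rewrite [X in (_ <= 3 * #|pred_of_set X|)%N](_ : _ = [set: _]%SET) ?leq_mul //.
by apply/setP=> w; rewrite !inE; apply/asboolP; exists a.
Qed.

Lemma lp_coord_solvable (R : realType) (d : nat) : exists C : nat,
  forall cm s L, (0 < s)%N -> (0 < L)%N ->
    coord_solvable cm (linear_programming R d L s) (C * (s * L)).
Proof.
have [J [C [[j0] HC]]] := search_bound R d.
pose A : finType := ({ffun J -> bool} * {ffun J -> bool})%type.
pose B : finType := (J * J)%type.
(* For [L >= 1] one has [(vertex_bits d L).+1 <= e * L], so the number of rounds is linear in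
   [L]. *)
pose e := (d + d`!).+1.
exists ((#|A| + #|B|) * (C * e))%N => cm [//|s] L _ L0.
have [query [kept strategyP]] := search_strategy R d J.
have Ws : searchable J (C * (e * L)) (@height_le R d (vertex_bits d L)).
  apply: searchable_leq (HC (vertex_bits d L) _ (fun x => id)) => //.
  by rewrite leq_mul2l /e mulSn /vertex_bits mulnC -add1n leq_add2r L0 orbT.
pose P := @lp_rounds R d J j0 query kept L s.+1 (C * (e * L))
  (constraints d L * 0.-tuple bool)%type (objective d L * 0.-tuple bool)%type fst fst.
have a0 : A by exact: ([ffun=> false], [ffun=> false]).
(* The protocol is deterministic, which both coin models allow. *)
exists 0%N, 0%N, (fun _ => compiled_round_protocol a0 (j0, j0) P (C * (e * L))).
split; first by case: cm.
move=> x y; have -> : ((#|A| + #|B|) * (C * e) * (s.+1 * L) =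
    s.+1 * ((#|A| + #|B|) * (C * (e * L))))%N by rewrite mulnCA !mulnA.
apply: (@succeeds_always _ _ _ _ _ _ (round_output P (y, [tuple])
  (rounds P (fun i => (x i, [tuple])) (y, [tuple]) (C * (e * L))).1)) => [w|].
  rewrite compiled_round_run (tuple0 (coord_coins w)).
  have -> // : (fun i => (x i, server_coins w i)) = (fun i => (x i, [tuple])).
  by apply/funext => i; rewrite (tuple0 (server_coins w i)).
exact: (@lp_rounds_correct R d J j0 query kept strategyP L s.+1 _ Ws _ _ fst fst
  (fun i => (x i, [tuple])) (y, [tuple]) L0).
Qed.

(** * Hardness of the index problem *)

(** Cauchy-Schwarz against the constant 1, from the squares of all differences. *)
Lemma sum_sqr_le (R : realDomainType) (U : finType) (g : U -> R) :
  (\sum_u g u) ^+ 2 <= #|U|%:R * \sum_u g u ^+ 2.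
Proof.
have : 0 <= \sum_u \sum_v (g u - g v) ^+ 2.
  by apply: sumr_ge0 => u _; apply: sumr_ge0 => v _; rewrite sqr_ge0.
have -> : \sum_u \sum_v (g u - g v) ^+ 2 =
    2 * (#|U|%:R * (\sum_u g u ^+ 2) - (\sum_u g u) ^+ 2).
  transitivity (\sum_u (#|U|%:R * g u ^+ 2 + \sum_v g v ^+ 2 - 2 * g u * \sum_v g v)).
    apply: eq_bigr => u _; rewrite -(sumr_const U) mulr_suml -big_split /= mulr_sumr -sumrB.
    by apply: eq_bigr => v _; rewrite mul1r; ring.
  rewrite sumrB big_split /= -mulr_sumr sumr_const -mulr_suml -mulr_sumr -mulr_natl; ring.
by rewrite pmulr_rge0 ?subr_ge0.
Qed.

Section Index.
Variable T : finType.
Let U := {ffun T -> bool}.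

(** The sign matrix of the index problem, positive where [t] is not in the set [u]; its columns are
    orthogonal. *)
Definition chi (u : U) (t : T) : rat := (-1) ^+ u t.

Definition flip (t : T) (u : U) : U := [ffun x => (x == t) (+) u x].

Lemma flipK t : involutive (flip t).
Proof. by move=> u; apply/ffunP=> x; rewrite !ffunE addKb. Qed.

Lemma chi_orthogonal t t' : \sum_u chi u t * chi u t' = if t == t' then #|U|%:R else 0.
Proof.
case: eqVneq => [<-|tt'].
  by rewrite -sumr_const; apply: eq_bigr => u _; rewrite /chi -expr2 sqrr_sign.
set S := \sum_u _; suff : S = - S by lra.
rewrite {1}/S (reindex_inj (inv_inj (flipK t))) -sumrN; apply: eq_bigr => u _.
by rewrite /chi !ffunE eqxx eq_sym (negbTE tt') /= signrN mulNr.
Qed.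

Lemma card_half t : (#|[pred u : U | ~~ u t]| * 2 = #|U|)%N.
Proof.
have -> : #|U| = (#|[pred u : U | ~~ u t]| + #|[predC [pred u : U | ~~ u t]]|)%N by rewrite cardC.
rewrite muln2 -addnn; congr (_ + _)%N.
rewrite -(card_image (inv_inj (flipK t))); apply: eq_card => u.
rewrite !inE negbK; apply/fintype.imageP/idP => [[v]|ut].
  by rewrite inE => vt ->; rewrite ffunE eqxx.
by exists (flip t u); rewrite ?flipK // inE ffunE eqxx ut.
Qed.

Variables (B : finType) (P : pred B) (tB : B -> T) (K e : nat).
Hypothesis fiber : forall t, #|[pred b | P b && (tB b == t)]| = K.
Hypothesis cardT : #|T| = (4 ^ e)%N.

Lemma card_fibered : #|P| = (#|T| * K)%N.
Proof.
rewrite -sum1_card (partition_big tB xpredT) //= -sum_nat_const; apply: eq_bigr => t _.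
by rewrite -(fiber t) -sum1_card; apply: eq_bigl => b; rewrite !inE.
Qed.

(** Lindsey's argument: Cauchy-Schwarz over the rows, after which orthogonality leaves only pairs of
    columns in one fiber. The bound is a fraction [2 ^- e] of all [#|U| * #|T| * K] entries. *)
Lemma rectangle_discrepancy (Q : U -> B -> bool) :
  (forall u b u' b', Q u b -> Q u' b' -> Q u b') ->
  `|\sum_(p : U * B | P p.2 && Q p.1 p.2) chi p.1 (tB p.2)| <= (#|U| * 2 ^ e * K)%:R.
Proof.
move=> cross; pose S u := [exists b, Q u b]; pose V b := P b && [exists u, Q u b].
pose g u := \sum_(b | V b) chi u (tB b).
have -> : \sum_(p : U * B | P p.2 && Q p.1 p.2) chi p.1 (tB p.2) =
    \sum_u (if S u then g u else 0).
  rewrite -big_mkcond pair_big_dep /=; apply: eq_bigl => -[u b] /=; rewrite /S /V.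
  apply/andP/and3P => [[Pb Qb]|[/existsP[b' Qb'] Pb /existsP[u' Qu']]].
    by split=> //; apply/existsP; [exists b|exists u].
  by split=> //; apply: cross Qb' Qu'.
set D := \sum_u _.
have gsq : \sum_u g u ^+ 2 <= (#|U| * (#|T| * K) * K)%:R.
  have -> : \sum_u g u ^+ 2 = \sum_(b | V b) \sum_(b' | V b')
      (if tB b == tB b' then #|U|%:R else 0).
    transitivity (\sum_u \sum_(b | V b) \sum_(b' | V b') chi u (tB b) * chi u (tB b')).
      by apply: eq_bigr => u _; rewrite expr2 mulr_suml; apply: eq_bigr => b _; rewrite mulr_sumr.
    rewrite exchange_big; apply: eq_bigr => b _; rewrite exchange_big.
    by apply: eq_bigr => b' _; rewrite chi_orthogonal.
  rewrite -card_fibered.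
  apply: (@le_trans _ _ (\sum_(b | P b) (#|U| * K)%:R)).
    rewrite [leLHS]big_mkcond [leRHS]big_mkcond; apply: ler_sum => b _.
    rewrite /V; case: (P b) => //=; case: ifP => // _.
    rewrite -big_mkcondr /= sumr_const -mulrnA ler_nat leq_mul2l; apply/orP; right.
    rewrite -(fiber (tB b)); apply: subset_leq_card; apply/fintype.subsetP => b'.
    by rewrite !inE eq_sym => /andP[/andP[-> _] ->].
  by rewrite sumr_const -mulrnA mulnAC.
have DU : D ^+ 2 <= ((#|U| * 2 ^ e * K)%:R) ^+ 2.
  apply: le_trans (sum_sqr_le _) _.
  apply: (@le_trans _ _ (#|U|%:R * \sum_u g u ^+ 2)).
    apply: ler_wpM2l => //; apply: ler_sum => u _; case: ifP => // _.
    by rewrite expr0n sqr_ge0.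
  apply: le_trans (ler_wpM2l (ler0n _ _) gsq) _.
  rewrite cardT -natrM -natrX ler_nat (_ : 4 = 2 ^ 2)%N // -expnM mulnC expnM.
  by rewrite !expnMn -!mulnn; lia.
by rewrite -(ler_pXn2r (n := 2)) ?nnegrE // real_normK // num_real.
Qed.

Variables (c : nat).

(** The accepted inputs with a given transcript form a rectangle, and fewer than [2 ^ c.+1]
    transcripts have length at most [c]. *)
Lemma transcript_discrepancy (tau : U -> B -> seq bool) (acc : U -> B -> bool) :
  (forall u b u' b', tau u b = tau u' b' -> tau u b' = tau u b /\ acc u b' = acc u' b') ->
  `|\sum_(p : U * B | [&& P p.2, acc p.1 p.2 & size (tau p.1 p.2) <= c]%N) chi p.1 (tB p.2)|
    <= (2 ^ c.+1 * (#|U| * 2 ^ e * K))%:R.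
Proof.
move=> cross.
pose code (p : U * B) : {bseq c of bool} := insub_bseq c (tau p.1 p.2).
have codeE p : (size (tau p.1 p.2) <= c)%N -> code p = tau p.1 p.2 :> seq bool.
  by move=> le; rewrite /code /insub_bseq val_insubd le.
rewrite (partition_big code xpredT) //=.
apply: le_trans (ler_norm_sum _ _ _) _.
apply: (@le_trans _ _ (\sum_(k : {bseq c of bool}) (#|U| * 2 ^ e * K)%:R)).
  apply: ler_sum => k _.
  have := @rectangle_discrepancy (fun u b => [&& acc u b, (size (tau u b) <= c)%N & tau u b == k]).
  move=> H; rewrite (eq_bigl (fun p => P p.2 &&
     [&& acc p.1 p.2, (size (tau p.1 p.2) <= c)%N & tau p.1 p.2 == k])).
    apply: H => u b u' b' /and3P[a1 s1 /eqP e1] /and3P[a2 s2 /eqP e2].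
    have [E1 E2] : tau u b' = tau u b /\ acc u b' = acc u' b' by apply: cross; rewrite e1 e2.
    by rewrite E1 E2 a2 s1 e1 eqxx.
  move=> p; rewrite -!andbA; do 2 congr (_ && _).
  by case: leqP => //= le; rewrite -(codeE _ le) (inj_eq val_inj).
rewrite sumr_const -mulrnA mulnC ler_nat leq_mul2r card_bseq card_bool; apply/orP; right.
by rewrite -[leqLHS]mul1n -(predn_exp 2) leq_pred.
Qed.

End Index.

Section IndexHardness.
Variable T : finType.
Let U := {ffun T -> bool}.
Variables (B : finType) (P : pred B) (tB : B -> T) (K c : nat).
Hypothesis fiber : forall t, #|[pred b | P b && (tB b == t)]| = K.
Hypothesis cardT : #|T| = (4 ^ (c + 5))%N.
Variables (Omega : finType) (tau : Omega -> U -> B -> seq bool)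
  (acc : Omega -> U -> B -> bool).
Hypothesis cross : forall w u b u' b', tau w u b = tau w u' b' ->
  tau w u b' = tau w u b /\ acc w u b' = acc w u' b'.

Lemma sum_half (F : B -> rat) :
  \sum_(p : U * B | P p.2 && ~~ p.1 (tB p.2)) F p.2 = #|U|%:R / 2 * \sum_(b | P b) F b.
Proof.
transitivity (\sum_(b | P b) \sum_(u : U | ~~ u (tB b)) F b).
  rewrite (exchange_big_dep xpredT) //= pair_big_dep /=.
  by apply: eq_bigl => p; rewrite andbC.
rewrite mulr_sumr; apply: eq_bigr => b _; rewrite sumr_const -[LHS]mulr_natl; congr (_ * _).
by rewrite -(card_half (tB b)) natrM mulfK.
Qed.

(** Relative to [#|Omega| * N], acceptance weighs at least 2/3 on pairs with [t] outside [u] and at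
    most 1/3 on the others. Over short transcripts the signed sum is thus at least 1/3 minus the
    weight of the long ones, while discrepancy keeps it below 1/8; the long ones weigh at least 1/3
    - 1/8 = 5/24. *)
Lemma index_hardness :
  (forall b (u : U), P b -> ~~ u (tB b) -> (2 * #|Omega| <= 3 * \sum_w acc w u b)%N) ->
  (forall b (u : U), P b -> u (tB b) -> (3 * \sum_w acc w u b <= #|Omega|)%N) ->
  5 / 24 * #|Omega|%:R * (#|U|%:R / 2 * #|P|%:R) <=
  \sum_w \sum_(p : U * B | P p.2 && ~~ p.1 (tB p.2)) (c < size (tau w p.1 p.2))%N%:R :> rat.
Proof.
move=> accG accB.
set N := #|U|%:R / 2 * #|P|%:R; set Y := \sum_w _; set M := #|Omega|%:R.
have PE : #|P|%:R = 4 ^+ (c + 5) * K%:R :> rat.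
  by rewrite (card_fibered fiber) natrM cardT natrX.
have cardG (b : bool) : \sum_(p : U * B | P p.2 && (p.1 (tB p.2) == b)) 1 = N.
  have cG : \sum_(p : U * B | P p.2 && ~~ p.1 (tB p.2)) 1 = N.
    by rewrite (sum_half (fun _ => 1)) sumr_const.
  case: b; last by rewrite -cG; apply: eq_bigl => p; case: (p.1 _).
  have : \sum_(p : U * B | P p.2) 1 = 2 * N :> rat.
    rewrite -(pair_big_dep xpredT (fun _ b => P b) (fun _ _ => 1)) /= !sumr_const /N.
    by rewrite -[LHS]mulr_natl; lra.
  rewrite (bigID (fun p : U * B => p.1 (tB p.2))) /= cG.
  rewrite (eq_bigl (fun p : U * B => P p.2 && (p.1 (tB p.2) == true))); first lra.
  by move=> p; rewrite eqb_id.
have disc : \sum_w \sum_(p : U * B | [&& P p.2, acc w p.1 p.2 & size (tau w p.1 p.2) <= c]%N)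
    chi p.1 (tB p.2) <= M * (N / 8).
  apply: (@le_trans _ _ (\sum_(w : Omega) N / 8)); last by rewrite sumr_const mulr_natl.
  apply: ler_sum => w _; apply: le_trans (ler_norm _) _.
  (* With exponent [e = c + 5] the discrepancy bound equals [N / 8]. *)
  apply: le_trans (transcript_discrepancy fiber cardT c (@cross w)) _.
  rewrite /N PE !natrM !natrX (_ : 4 = 2 * 2 :> rat) // exprMn addnC exprS !exprD.
  by have := ler0n rat K; have := ler0n rat #|U|; nra.
have split_sum : \sum_w \sum_(p : U * B | [&& P p.2, acc w p.1 p.2 & size (tau w p.1 p.2) <= c]%N)
    chi p.1 (tB p.2) >=
  \sum_w (\sum_(p : U * B | P p.2 && ~~ p.1 (tB p.2))
     ((acc w p.1 p.2)%:R - (c < size (tau w p.1 p.2))%N%:R) -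
   \sum_(p : U * B | P p.2 && p.1 (tB p.2)) (acc w p.1 p.2)%:R).
  apply: ler_sum => w _.
  rewrite [leLHS](_ : _ = \sum_(p : U * B | P p.2) (if p.1 (tB p.2) then - (acc w p.1 p.2)%:R
      else (acc w p.1 p.2)%:R - (c < size (tau w p.1 p.2))%N%:R)).
    rewrite big_mkcondr /=; apply: ler_sum => p _; rewrite /chi; case: leqP => _; rewrite ?andbT ?andbF;
    by case: (acc _ _ _); case: (p.1 _); rewrite /= ?expr0 ?expr1; lra.
  rewrite [RHS](bigID (fun p : U * B => p.1 (tB p.2))) /= addrC -sumrN; congr (_ + _).
    by apply: eq_bigr => p /andP[_ /negbTE ->].
  by apply: eq_bigr => p /andP[_ ->].
have G : 2 / 3 * M * N <= \sum_w \sum_(p : U * B | P p.2 && ~~ p.1 (tB p.2)) (acc w p.1 p.2)%:R.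
  rewrite exchange_big /= -(cardG false) mulr_sumr.
  rewrite (eq_bigl (fun p : U * B => P p.2 && ~~ p.1 (tB p.2))); last by move=> p; case: (p.1 _).
  apply: ler_sum => p /andP[Pp up]; rewrite -natr_sum mulr1.
  have : (2 * #|Omega|)%N%:R <= (3 * \sum_w acc w p.1 p.2)%N%:R :> rat by rewrite ler_nat accG.
  by rewrite !natrM -/M; lra.
have Bd : \sum_w \sum_(p : U * B | P p.2 && p.1 (tB p.2)) (acc w p.1 p.2)%:R <= 1 / 3 * M * N.
  rewrite exchange_big /= -(cardG true) mulr_sumr.
  rewrite [leRHS](eq_bigl (fun p : U * B => P p.2 && p.1 (tB p.2))); last by move=> p; rewrite eqb_id.
  apply: ler_sum => p /andP[Pp up]; rewrite -natr_sum mulr1.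
  have : (3 * \sum_w acc w p.1 p.2)%N%:R <= #|Omega|%:R :> rat by rewrite ler_nat accB.
  by rewrite !natrM -/M; lra.
move: split_sum; rewrite sumrB.
under [X in X - _ <= _]eq_bigr do rewrite sumrB.
rewrite sumrB -/Y; lra.
Qed.

End IndexHardness.

Section Acceptance.
Variables (s p m : nat) (O : Type).
Let Omega : finType := (p.-tuple bool * m.-tuple bool * {ffun 'I_s -> m.-tuple bool})%type.
Variables (run : coins s p m -> option O) (good : O -> Prop) (ok : O -> bool).

Definition accepts (w : Omega) : bool := if run (coins_of w) is Some a then ok a else false.

Lemma accepts_often : succeeds run good -> (forall a, good a -> ok a) ->
  (2 * #|Omega| <= 3 * \sum_w accepts w)%N.
Proof.
case=> _ H gok; rewrite -cardsT; apply: leq_trans H _; rewrite leq_mul2l /= -sum1_card big_mkcond.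
apply: leq_sum => w _; rewrite inE /accepts; case: asboolP => // -[a -> /gok ->] //.
Qed.

Lemma accepts_rarely : succeeds run good -> (forall a, good a -> ~~ ok a) ->
  (3 * \sum_w accepts w <= #|Omega|)%N.
Proof.
case=> _; rewrite cardsT => H gok; set S := [set w | _]%SET in H.
have : (\sum_w accepts w + #|S| <= #|Omega|)%N.
  rewrite -[X in (_ + X)%N]sum1_card [X in (_ + X)%N]big_mkcond -big_split /= -sum1_card.
  apply: leq_sum => w _; rewrite inE /accepts; case: asboolP => [[a -> /gok /negbTE ->] //|_].
  by case: run => // a; case: ok.
have H2 : (2 * #|Omega| <= 3 * #|S|)%N := H.
move: H2; set M := #|Omega|; set X := (\sum_w _)%N; lia.
Qed.

Lemma coin_space_gt0 : (0 < #|Omega|)%N.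
Proof.
apply/card_gt0P; exists (nseq_tuple p false, nseq_tuple m false, [ffun=> nseq_tuple m false]).
by [].
Qed.

End Acceptance.

(** * Transcripts of protocols *)

Local Open Scope nat_scope.

Section CoordinatorTrace.
Variables (s : nat) (X Y O : Type) (P : coord_protocol s X Y O) (y : Y).

Fixpoint coord_trace (x : 'I_s -> X) (h : 'I_s -> seq bool) n :
    option (('I_s -> seq bool) * O) :=
  match coord_next P y h, n with
  | inr a, _ => Some (h, a)
  | inl _, 0 => None
  | inl i, n'.+1 => coord_trace x
      (fun j => if j == i then rcons (h i) (coord_new_bit P x y h i) else h j) n'
  end.

Lemma coord_run_trace x h n : coord_run_from P x y h n = omap snd (coord_trace x h n).
Proof.
by elim: n h => [|n IH] h /=; case: (coord_next P y h) => // i; rewrite IH.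
Qed.

Lemma coord_trace_ext x h n h' a i : coord_trace x h n = Some (h', a) ->
  exists r, h' i = h i ++ r.
Proof.
elim: n h => [|n IH] h /=; case: (coord_next P y h) => [j|b] //.
- by case=> <- _; exists [::]; rewrite cats0.
- move=> /IH[r ->]; case: eqP => [->|_]; last by exists r.
  by eexists; rewrite -cats1 -catA.
by case=> <- _; exists [::]; rewrite cats0.
Qed.

Lemma coord_trace_size x h n h' a : coord_trace x h n = Some (h', a) ->
  \sum_i size (h' i) <= \sum_i size (h i) + n.
Proof.
elim: n h => [|n IH] h /=; case: (coord_next P y h) => [j|b] //.
- by case=> <- _; rewrite addn0.
- move=> /IH; rewrite addnS -addSn; congr (_ <= _ + _).
  rewrite (bigD1 j) //= eqxx size_rcons [in RHS](bigD1 j) //=; congr (_.+1 + _).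
  by apply: eq_bigr => i /negbTE ->.
by case=> <- _; rewrite leq_addr.
Qed.

(** A condition on one channel and one input only, which is why transcripts give rectangles. *)
Definition coord_consistent i (v : X) (c : seq bool) : Prop := forall k, k < size c ->
  channel_turn P i (take k c) -> server_bit P i v (take k c) = nth false c k.

Lemma coord_trace_consistent x h n h' a : coord_trace x h n = Some (h', a) ->
  (forall i, coord_consistent i (x i) (h i)) -> forall i, coord_consistent i (x i) (h' i).
Proof.
elim: n h => [|n IH] h /=; case: (coord_next P y h) => [j|b] //; try by case=> <-.
move=> /IH H ch; apply: H => i; case: eqP => [->|_]; last exact: ch.
move=> k; rewrite size_rcons ltnS leq_eqVlt => /orP[/eqP ->|lt].
  rewrite nth_rcons ltnn eqxx -cats1 take_size_cat // => turn.
  by rewrite /coord_new_bit turn.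
by rewrite nth_rcons lt -cats1 takel_cat ?(ltnW lt) //; apply: ch.
Qed.

(** With [y] fixed, two runs can first differ only at a bit of a server, and consistency with the
    final contents fixes these bits. *)
Lemma coord_trace_cross x x' h n h' a : coord_trace x h n = Some (h', a) ->
  (forall i, coord_consistent i (x' i) (h' i)) -> coord_trace x' h n = Some (h', a).
Proof.
move=> + cx'; elim: n h => [|n IH] h /=; case: (coord_next P y h) => [j|b] //.
move=> tr; have [r] := coord_trace_ext j tr; rewrite eqxx cat_rcons => hE.
rewrite (_ : coord_new_bit P x' y h j = coord_new_bit P x y h j) ?IH //.
rewrite /coord_new_bit; case: ifP => // turn.
have := cx' j (size (h j)); rewrite hE size_cat /= addnS ltnS leq_addr take_size_cat //.
by rewrite nth_cat ltnn subnn /= => -> //; rewrite /coord_new_bit turn.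
Qed.

End CoordinatorTrace.

Section BoardTrace.
Variables (s : nat) (X Y O : Type) (P : board_protocol s X Y O) (y : Y).

Fixpoint board_trace (x : 'I_s -> X) (h : seq bool) n : option (seq bool * O) :=
  match board_next P h, n with
  | NobodySpeaks, _ => Some (h, board_output P y h)
  | _, 0 => None
  | CoordinatorSpeaks, n'.+1 => board_trace x (rcons h (board_coord_bit P y h)) n'
  | ServerSpeaks i, n'.+1 => board_trace x (rcons h (board_server_bit P i (x i) h)) n'
  end.

Lemma board_run_trace x h n : board_run_from P x y h n = omap snd (board_trace x h n).
Proof. by elim: n h => [|n IH] h /=; case: (board_next P h). Qed.

Lemma board_trace_ext x h n h' a : board_trace x h n = Some (h', a) ->
  exists r, h' = h ++ r.
Proof.
elim: n h => [|n IH] h /=; case: (board_next P h) => [|j|] //;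
  try by case=> <- _; exists [::]; rewrite cats0.
all: by move=> /IH[r ->]; rewrite cat_rcons; eexists.
Qed.

Lemma board_trace_size x h n h' a : board_trace x h n = Some (h', a) ->
  size h' <= size h + n.
Proof.
elim: n h => [|n IH] h /=; case: (board_next P h) => [|j|] //;
  try by case=> <- _; rewrite leq_addr.
all: by move=> /IH; rewrite size_rcons addSnnS.
Qed.

Definition board_consistent i (v : X) (c : seq bool) : Prop := forall k, k < size c ->
  board_next P (take k c) = ServerSpeaks i ->
  board_server_bit P i v (take k c) = nth false c k.

Lemma board_trace_consistent x h n h' a : board_trace x h n = Some (h', a) ->
  (forall i, board_consistent i (x i) h) -> forall i, board_consistent i (x i) h'.
Proof.
elim: n h => [|n IH] h /=; case E: (board_next P h) => [|j|] //; try by case=> <-.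
all: move=> /IH H ch; apply: H => i k; rewrite size_rcons ltnS leq_eqVlt => /orP[/eqP ->|lt].
1, 3: by rewrite nth_rcons ltnn eqxx -cats1 take_size_cat // E // => -[->].
all: by rewrite nth_rcons lt -cats1 takel_cat ?(ltnW lt) //; apply: ch.
Qed.

Lemma board_trace_cross x x' h n h' a : board_trace x h n = Some (h', a) ->
  (forall i, board_consistent i (x' i) h') -> board_trace x' h n = Some (h', a).
Proof.
move=> + cx'; elim: n h => [|n IH] h /=; case E: (board_next P h) => [|j|] //; first exact: IH.
move=> tr; have [r] := board_trace_ext tr; rewrite cat_rcons => hE.
rewrite (_ : board_server_bit P j (x' j) h = board_server_bit P j (x j) h) ?IH //.
have := cx' j (size h); rewrite hE size_cat /= addnS ltnS leq_addr take_size_cat //.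
by rewrite nth_cat ltnn subnn /= => ->.
Qed.

Definition board_speaks i (c : seq bool) : bool :=
  [exists k : 'I_(size c), `[< board_next P (take k c) = ServerSpeaks i >]].

Lemma board_silent_consistent i v c : ~~ board_speaks i c -> board_consistent i v c.
Proof.
move=> /existsPn silent k lt nx; by have /asboolP := silent (Ordinal lt).
Qed.

Lemma board_speakers_size c : #|[pred i | board_speaks i c]| <= size c.
Proof.
pose f (k : 'I_(size c)) : option 'I_s :=
  if board_next P (take k c) is ServerSpeaks i then Some i else None.
rewrite -[leqRHS]card_ord -(card_image Some_inj); apply: leq_trans (leq_image_card f _).
apply: subset_leq_card; apply/fintype.subsetP => oi /fintype.imageP[i + ->].
rewrite inE => /existsP[k /asboolP E]; apply/fintype.imageP; exists k => //.
by rewrite /f E.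
Qed.

End BoardTrace.

(** Acceptance survives a change at an untouched server, so each server is touched with probability
    at least 2/3 - 1/3. At most [n] are touched in any run. *)
Lemma or_counting (s n : nat) (Omega : finType) (acc : Omega -> bool)
    (acc' touch : 'I_s -> Omega -> bool) :
  0 < #|Omega| ->
  (forall i w, acc w -> ~~ touch i w -> acc' i w) ->
  2 * #|Omega| <= 3 * \sum_w acc w ->
  (forall i, 3 * \sum_w acc' i w <= #|Omega|) ->
  (forall w, \sum_i touch i w <= n) -> s <= 3 * n.
Proof.
move=> M0 sub many few touchn.
have touched i : #|Omega| <= 3 * \sum_w touch i w.
  have : \sum_w acc w <= \sum_w acc' i w + \sum_w touch i w.
    rewrite -big_split; apply: leq_sum => w _ /=.
    by have := sub i w; case: (acc w) (touch i w) (acc' i w) => [] [] [] //= /(_ isT isT).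
  by have := few i; lia.
rewrite -(leq_pmul2r M0).
apply: (@leq_trans (\sum_(i < s) 3 * \sum_w touch i w)).
  by rewrite -[s in leqLHS]card_ord -sum_nat_const; apply: leq_sum.
rewrite -big_distrr exchange_big /= -mulnA leq_mul2l /= mulnC -sum_nat_const.
exact: leq_sum.
Qed.

(** * From transcripts to communication bounds in both models *)

Section ProtocolBounds.
Variables (T : finType) (r : nat) (Pb : problem r.+1) (y0 : coord_input Pb).
Let U := {ffun T -> bool}.
Let Z : finType := (T * {ffun 'I_r -> U})%type.
Variables (f0 : T -> server_input Pb) (f : U -> server_input Pb) (ok : answer Pb -> bool).

Definition index_input (z : Z) (k : 'I_r.+1) : server_input Pb :=
  if unlift ord0 k is Some j then f (z.2 j) else f0 z.1.

Definition legal : pred Z := fun z => [forall j, ~~ z.2 j z.1].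

Hypothesis embeds : forall z a, correct (index_input z) y0 a -> ok a = legal z.

Definition update (j : 'I_r) (z : Z) (u : U) : Z :=
  (z.1, [ffun i => if i == j then u else z.2 i]).

Lemma index_input_update j z u : index_input (update j z u) (lift ord0 j) = f u.
Proof. by rewrite /index_input liftK ffunE eqxx. Qed.

Lemma index_input_update_ne j z u u' k : k != lift ord0 j ->
  index_input (update j z u) k = index_input (update j z u') k.
Proof.
rewrite /index_input; case: unliftP => [i ->|] //; rewrite (inj_eq lift_inj) => ij.
by rewrite !ffunE (negbTE ij).
Qed.

Lemma legal_update j z u : legal z -> legal (update j z u) = ~~ u z.1.
Proof.
move=> /forallP lz; apply/forallP/idP => [/(_ j)|uz i]; first by rewrite ffunE eqxx.
by rewrite ffunE; case: eqP.
Qed.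

Lemma legal_fiber t : #|[pred z | legal z && (z.1 == t)]| = (#|U| %/ 2) ^ r.
Proof.
rewrite -[X in _ ^ X](card_ord r) -(card_half t) mulnK //.
have := card_ffun_on 'I_r [pred u : U | ~~ u t]; rewrite !card_ord => <-.
rewrite -(card_imset (mem (ffun_on _)) (_ : injective (fun g : {ffun 'I_r -> U} => (t, g)))).
  apply: eq_card => -[t' g]; rewrite !inE /legal /=.
  apply/andP/imsetP => [[/forallP lg /eqP E]|[g' + [-> ->]]].
    by exists g; rewrite ?E //; apply/ffun_onP => j; rewrite inE -E; apply: lg.
  by move=> /ffun_onP lg; split=> //; apply/forallP => j; have := lg j; rewrite inE.
by move=> g g' [].
Qed.

(** Exchanging the fresh set with that of server [j] is an involution of these pairs, so resampling
    one set preserves the uniform distribution on legal inputs. One distribution then serves all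
    servers. *)
Lemma sum_resample j (F : Z -> rat) :
  (\sum_(p : U * Z | legal p.2 && ~~ p.1 p.2.1) F (update j p.2 p.1) =
   \sum_(p : U * Z | legal p.2 && ~~ p.1 p.2.1) F p.2)%R.
Proof.
pose swap (p : U * Z) : U * Z := (p.2.2 j, update j p.2 p.1).
have swapK : involutive swap.
  move=> [u [t g]]; rewrite /swap /update /= ffunE eqxx; congr (_, (_, _)).
  by apply/ffunP => i; rewrite !ffunE; case: eqP => [->|].
rewrite [RHS](reindex_inj (inv_inj swapK)) /=; apply: eq_bigl => -[u z] /=.
apply/andP/andP => [[lz uz]|[lz uz]].
  by rewrite legal_update // uz; split=> //; apply: (forallP lz).
have lz' : legal z.
  apply/forallP=> i; have := forallP lz i; rewrite ffunE; case: eqP => // -> _.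
  exact: uz.
by split=> //; rewrite -(legal_update j).
Qed.

Section Coordinator.
Variables (p m n : nat) (Pr : p.-tuple bool ->
  coord_protocol r.+1 (server_input Pb * m.-tuple bool) (coord_input Pb * m.-tuple bool) (answer Pb)).
Let Omega : finType := (p.-tuple bool * m.-tuple bool * {ffun 'I_r.+1 -> m.-tuple bool})%type.

Let xw (x : 'I_r.+1 -> server_input Pb) (w : Omega) i := (x i, server_coins (coins_of w) i).
Let yw (w : Omega) := (y0, coord_coins (coins_of w)).
Let tr x w := coord_trace (Pr (public_coins (coins_of w))) (yw w) (xw x w) (fun=> [::]) n.

Definition coord_random_run x (w : coins r.+1 p m) :=
  coord_run (Pr (public_coins w)) (fun i => (x i, server_coins w i)) (y0, coord_coins w) n.

Hypothesis Pr_succeeds : forall x, succeeds (coord_random_run x) (correct x y0).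

Let acc x w := accepts (coord_random_run x) ok w.

Let trP x w : exists h a, tr x w = Some (h, a) /\ acc x w = ok a.
Proof.
have [/(_ (coins_of w)) + _] := Pr_succeeds x.
rewrite /acc /accepts /coord_random_run /coord_run coord_run_trace -/(xw x w) -/(yw w) -/(tr x w).
by case: (tr x w) => [[h a]|] //=; exists h, a.
Qed.

Let hist x w i := if tr x w is Some (h, _) then h i else [::].

Let hist_size x w : \sum_i size (hist x w i) <= n.
Proof.
have [h [a [E _]]] := trP x w; rewrite /hist E.
by apply: leq_trans (coord_trace_size E) _; rewrite big1.
Qed.

(** The content of one channel acts as the transcript between server [i] and all other parties
    together. *)
Let hist_cross x1 x2 x3 w i :
  x3 i = x1 i -> (forall k, k != i -> x3 k = x2 k) -> hist x1 w i = hist x2 w i ->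
  hist x3 w i = hist x2 w i /\ acc x3 w = acc x2 w.
Proof.
have [h1 [a1 [E1 A1]]] := trP x1 w; have [h2 [a2 [E2 A2]]] := trP x2 w.
have [h3 [a3 [E3 A3]]] := trP x3 w.
rewrite /hist E1 E2 E3 A3 A2 => x31 x32 h12.
have : tr x3 w = Some (h2, a2).
  apply: (coord_trace_cross E2) => k; case: (eqVneq k i) => [->|ki].
    by rewrite /xw x31 -h12; apply: (coord_trace_consistent E1).
  by rewrite /xw x32 //; apply: (coord_trace_consistent E2).
by rewrite E3 => -[-> ->].
Qed.

(** On a uniform legal input each of the [r] channels has more than [c] bits with probability at
    least 5/24, hence at least [5 / 24 * c.+1] bits on average. These averages add up to at most
    [n]. *)
Lemma coord_index_bound_run c : #|T| = 4 ^ (c + 5) -> 5 * (r * c.+1) <= 24 * n.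
Proof.
move=> cardT; pose M : rat := (#|Omega|%:R)%R.
have M0 : (0 < M)%R by rewrite ltr0n coin_space_gt0.
have U0 : (0 < #|U|%:R :> rat)%R by rewrite ltr0n; apply/card_gt0P; exists [ffun=> false].
have P0 : (0 < #|legal|%:R :> rat)%R.
  have : 0 < #|T| by rewrite cardT expn_gt0.
  case/card_gt0P => t _; rewrite ltr0n; apply/card_gt0P; exists (t, [ffun=> [ffun=> false]]).
  by rewrite unfold_in; apply/forallP => j; rewrite !ffunE.
have many z : legal z -> 2 * #|Omega| <= 3 * \sum_w acc (index_input z) w.
  by move=> lz; apply: accepts_often (Pr_succeeds _) _ => a /embeds ->.
have few z : ~~ legal z -> 3 * \sum_w acc (index_input z) w <= #|Omega|.
  by move=> lz; apply: accepts_rarely (Pr_succeeds _) _ => a /embeds ->.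
have hard j : (5 / 24 * M * #|legal|%:R <=
    \sum_(w : Omega) \sum_(z | legal z) (c < size (hist (index_input z) w (lift ord0 j)))%N%:R)%R.
  have := @index_hardness T Z legal fst _ c legal_fiber cardT Omega
    (fun w u z => hist (index_input (update j z u)) w (lift ord0 j))
    (fun w u z => acc (index_input (update j z u)) w) _ _ _.
  have C w u b u' b' : hist (index_input (update j b u)) w (lift ord0 j) =
      hist (index_input (update j b' u')) w (lift ord0 j) ->
      hist (index_input (update j b' u)) w (lift ord0 j) =
        hist (index_input (update j b u)) w (lift ord0 j) /\
      acc (index_input (update j b' u)) w = acc (index_input (update j b' u')) w.
    move=> E; rewrite E; apply: hist_cross E; first by rewrite !index_input_update.
    by move=> k kj; apply: index_input_update_ne.
  move=> /(_ C) H; have {H} := H _ _.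
  have G b (u : U) : legal b -> ~~ u b.1 ->
      2 * #|Omega| <= 3 * \sum_w acc (index_input (update j b u)) w.
    by move=> lb ub; apply: many; rewrite legal_update.
  have Bd b (u : U) : legal b -> u b.1 ->
      3 * \sum_w acc (index_input (update j b u)) w <= #|Omega|.
    by move=> lb ub; apply: few; rewrite legal_update // ub.
  move=> /(_ G Bd).
  pose F w z : rat := ((c < size (hist (index_input z) w (lift ord0 j)))%N%:R)%R.
  rewrite [leRHS](eq_bigr (fun w => #|U|%:R / 2 * \sum_(z | legal z) F w z)%R); last first.
    by move=> w _; rewrite (sum_resample j (F w)) (sum_half legal fst (F w)).
  rewrite -mulr_sumr mulrCA ler_pM2l //; by rewrite divr_gt0.
have : (\sum_(j < r) (c.+1)%:R * (5 / 24 * M * #|legal|%:R) <= n%:R * M * #|legal|%:R :> rat)%R.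
  apply: (@le_trans _ _ (\sum_(w : Omega) \sum_(z | legal z) n%:R)%R); last first.
    by rewrite !sumr_const -[leLHS]mulr_natr -[X in (X * _ <= _)%R]mulr_natr mulrAC.
  apply: (@le_trans _ _ (\sum_(j < r) \sum_(w : Omega) \sum_(z | legal z)
      (size (hist (index_input z) w (lift ord0 j)))%:R)%R).
    apply: ler_sum => j _; apply: le_trans (ler_wpM2l (ler0n _ _) (hard j)) _.
    rewrite mulr_sumr; apply: ler_sum => w _; rewrite mulr_sumr; apply: ler_sum => z _.
    by rewrite -natrM ler_nat; case: leqP => //=; rewrite ?muln1 ?muln0.
  rewrite exchange_big; apply: ler_sum => w _ /=; rewrite exchange_big; apply: ler_sum => z _.
  rewrite -natr_sum ler_nat; apply: leq_trans (hist_size (index_input z) w).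
  by rewrite big_ord_recl leq_addl.
rewrite sumr_const card_ord -mulr_natl => H.
rewrite -(ler_nat rat) !natrM.
have ML : (0 < M * #|legal|%:R)%R by rewrite mulr_gt0.
rewrite -(ler_pM2r ML); lra.
Qed.

Lemma coord_or_bound_run (e0 e1 : server_input Pb) :
  (forall a, correct (fun=> e0) y0 a -> ok a) ->
  (forall i a, correct (fun k => if k == i then e1 else e0) y0 a -> ~~ ok a) ->
  r.+1 <= 3 * n.
Proof.
move=> ok0 ok1.
apply: (@or_counting _ _ Omega (acc (fun=> e0)) (fun i => acc (fun k => if k == i then e1 else e0))
   (fun i w => hist (fun=> e0) w i != [::])).
- exact: coin_space_gt0.
- move=> i w; rewrite negbK => + /eqP h0.
  have [h [a [E ->]]] := trP (fun=> e0) w; have [h' [a' [E' ->]]] := trP (fun k => if k == i then e1 else e0) w.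
  have : tr (fun k => if k == i then e1 else e0) w = Some (h, a).
    apply: (coord_trace_cross E) => k; rewrite /xw; case: eqP => [->|_].
      by move: h0; rewrite /hist E => ->.
    by apply: (coord_trace_consistent E).
  by rewrite E' => -[_ ->].
- by apply: accepts_often (Pr_succeeds _) _ => a /ok0.
- by move=> i; apply: accepts_rarely (Pr_succeeds _) _ => a /ok1.
move=> w; apply: leq_trans (hist_size (fun=> e0) w); apply: leq_sum => i _.
by case: (hist _ _ _).
Qed.

End Coordinator.

Section Board.
Variables (p m n : nat) (Pr : p.-tuple bool ->
  board_protocol r.+1 (server_input Pb * m.-tuple bool) (coord_input Pb * m.-tuple bool) (answer Pb)).
Let Omega : finType := (p.-tuple bool * m.-tuple bool * {ffun 'I_r.+1 -> m.-tuple bool})%type.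

Let xw (x : 'I_r.+1 -> server_input Pb) (w : Omega) i := (x i, server_coins (coins_of w) i).
Let yw (w : Omega) := (y0, coord_coins (coins_of w)).
Let tr x w := board_trace (Pr (public_coins (coins_of w))) (yw w) (xw x w) [::] n.

Definition board_random_run x (w : coins r.+1 p m) :=
  board_run (Pr (public_coins w)) (fun i => (x i, server_coins w i)) (y0, coord_coins w) n.

Hypothesis Pr_succeeds : forall x, succeeds (board_random_run x) (correct x y0).

Let acc x w := accepts (board_random_run x) ok w.

Let trP x w : exists h a, tr x w = Some (h, a) /\ acc x w = ok a.
Proof.
have [/(_ (coins_of w)) + _] := Pr_succeeds x.
rewrite /acc /accepts /board_random_run /board_run board_run_trace -/(xw x w) -/(yw w) -/(tr x w).
by case: (tr x w) => [[h a]|] //=; exists h, a.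
Qed.

Let hist x w := if tr x w is Some (h, _) then h else [::].

Let hist_size x w : size (hist x w) <= n.
Proof. by have [h [a [E _]]] := trP x w; rewrite /hist E; apply: board_trace_size E. Qed.

Let hist_cross x1 x2 x3 w i :
  x3 i = x1 i -> (forall k, k != i -> x3 k = x2 k) -> hist x1 w = hist x2 w ->
  hist x3 w = hist x2 w /\ acc x3 w = acc x2 w.
Proof.
have [h1 [a1 [E1 A1]]] := trP x1 w; have [h2 [a2 [E2 A2]]] := trP x2 w.
have [h3 [a3 [E3 A3]]] := trP x3 w.
rewrite /hist E1 E2 E3 A3 A2 => x31 x32 h12.
have : tr x3 w = Some (h2, a2).
  apply: (board_trace_cross E2) => k; case: (eqVneq k i) => [->|ki].
    by rewrite /xw x31 -h12; apply: (board_trace_consistent E1).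
  by rewrite /xw x32 //; apply: (board_trace_consistent E2).
by rewrite E3 => -[-> ->].
Qed.

(** One server holds an arbitrary set and the others empty ones. If [n <= c], no transcript is
    longer than [c], against [index_hardness]. *)
Lemma board_index_bound_run c : 0 < r -> #|T| = 4 ^ (c + 5) -> c < n.
Proof.
move=> r0 cardT; rewrite ltnNge; apply/negP => le_nc.
pose j0 := Ordinal r0; pose z t : Z := (t, [ffun=> [ffun=> false]]).
have lz t : legal (z t) by apply/forallP => j; rewrite !ffunE.
pose x t u := index_input (update j0 (z t) u).
have fib (t : T) : #|[pred b | xpredT b && (b == t)]| = 1 by rewrite -(card1 t); apply: eq_card.
have C w (u : U) t (u' : U) t' : hist (x t u) w = hist (x t' u') w ->
    hist (x t' u) w = hist (x t u) w /\ acc (x t' u) w = acc (x t' u') w.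
  move=> E; rewrite E; apply: (@hist_cross _ _ _ _ (lift ord0 j0)) E.
    by rewrite /x !index_input_update.
  by move=> k kj; apply: index_input_update_ne.
have G t (u : U) : xpredT t -> ~~ u t -> 2 * #|Omega| <= 3 * \sum_w acc (x t u) w.
  move=> _ ut; apply: accepts_often (Pr_succeeds _) _ => a /embeds ->.
  by rewrite legal_update.
have Bd t (u : U) : xpredT t -> u t -> 3 * \sum_w acc (x t u) w <= #|Omega|.
  move=> _ ut; apply: accepts_rarely (Pr_succeeds _) _ => a /embeds ->.
  by rewrite legal_update // ut.
have := @index_hardness T T xpredT id 1 c fib cardT Omega (fun w u t => hist (x t u) w)
  (fun w u t => acc (x t u) w) C G Bd.
rewrite big1 => [|w _]; last first.
  by rewrite big1 // => q _; rewrite ltnNge (leq_trans (hist_size _ _) le_nc).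
apply/negP; rewrite -ltNge.
have M0 : (0 < #|Omega|%:R :> rat)%R by rewrite ltr0n coin_space_gt0.
have U0 : (0 < #|U|%:R :> rat)%R by rewrite ltr0n; apply/card_gt0P; exists [ffun=> false].
have T0 : (0 < #|T|%:R :> rat)%R by rewrite ltr0n cardT expn_gt0.
by rewrite !mulr_gt0.
Qed.

Lemma board_or_bound_run (e0 e1 : server_input Pb) :
  (forall a, correct (fun=> e0) y0 a -> ok a) ->
  (forall i a, correct (fun k => if k == i then e1 else e0) y0 a -> ~~ ok a) ->
  r.+1 <= 3 * n.
Proof.
move=> ok0 ok1.
apply: (@or_counting _ _ Omega (acc (fun=> e0)) (fun i => acc (fun k => if k == i then e1 else e0))
   (fun i w => board_speaks (Pr (public_coins (coins_of w))) i (hist (fun=> e0) w))).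
- exact: coin_space_gt0.
- move=> i w + silent.
  have [h [a [E ->]]] := trP (fun=> e0) w; have [h' [a' [E' ->]]] := trP (fun k => if k == i then e1 else e0) w.
  have : tr (fun k => if k == i then e1 else e0) w = Some (h, a).
    apply: (board_trace_cross E) => k; rewrite /xw; case: eqP => [->|_].
      by apply: board_silent_consistent; move: silent; rewrite /hist E.
    by apply: (board_trace_consistent E).
  by rewrite E' => -[_ ->].
- by apply: accepts_often (Pr_succeeds _) _ => a /ok0.
- by move=> i; apply: accepts_rarely (Pr_succeeds _) _ => a /ok1.
move=> w; apply: leq_trans (hist_size (fun=> e0) w).
apply: leq_trans (board_speakers_size (Pr (public_coins (coins_of w))) _).
by rewrite -sum1_card [leqRHS]big_mkcond; apply: leq_sum => i _; rewrite inE; case: ifP.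
Qed.

End Board.

End ProtocolBounds.

(** * Linear programs encoding the index problem *)

Local Open Scope ring_scope.

Section PlanarConstraints.
Variables (R : realType) (d' L : nat).
Let d := d'.+2.

(** Makes any row legal by construction; [parabola_feasible] checks that the coefficients in use are
    unchanged. *)
Definition clip (z : int) : int := if `|z| < 2 ^+ L then z else 0.

Lemma clip_bits z : `|clip z| < 2 ^+ L.
Proof. by rewrite /clip; case: ifP => // _; rewrite normr0 exprn_gt0. Qed.

Lemma clip_id z : `|z| < 2 ^+ L -> clip z = z.
Proof. by rewrite /clip => ->. Qed.

Definition planar_lhs n (c : 'I_n -> int * int * int) : 'M[int]_(n, d) :=
  \matrix_(i, j) clip (if j == 0 :> nat then (c i).1.1 else if j == 1 :> nat then (c i).1.2 else 0).

Lemma planar_lhs_bits n (c : 'I_n -> int * int * int) i j : `|planar_lhs c i j| < 2 ^+ L.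
Proof. by rewrite mxE clip_bits. Qed.

Lemma planar_rhs_bits n (c : 'I_n -> int * int * int) i :
  `|(\col_i clip (c i).2) i 0| < 2 ^+ L.
Proof. by rewrite mxE clip_bits. Qed.

(* The rows [a x0 + b x1 <= e] for [(a, b, e)] in the range of [c]. *)
Definition planar n (c : 'I_n -> int * int * int) : constraints d L :=
  Constraints (planar_lhs_bits c) (planar_rhs_bits c).

Let x0 (x : 'cV[R]_d) := x ord0 0.
Let x1 (x : 'cV[R]_d) := x (lift ord0 ord0) 0.

Lemma planar_row n (c : 'I_n -> int * int * int) (x : 'cV[R]_d) k :
  (map_mx intr (planar_lhs c) *m x) k 0 =
  (clip (c k).1.1)%:~R * x0 x + (clip (c k).1.2)%:~R * x1 x.
Proof.
rewrite mxE !big_ord_recl big1 ?addr0 => [|i _]; first by rewrite !mxE.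
by rewrite !mxE /= /clip normr0 exprn_gt0 ?mul0r.
Qed.

Definition no_constraint : constraints d L := planar (fun i : 'I_0 => (0, 0, 0)).

Definition contradiction_row : constraints d L := planar (fun i : 'I_1 => (0, 0, -1)).

Section Parabola.
Variable N : nat.
Let T := 'I_N.

(** Two equations as four inequalities, pinning the first two coordinates to [(t, t^2)]. *)
Definition point_rows (t : T) (i : 'I_4) : int * int * int :=
  nth (0, 0, 0) [:: (1, 0, (t : nat)%:Z); (-1, 0, - (t : nat)%:Z);
    (0, 1, ((t ^ 2)%N : nat)%:Z); (0, -1, - ((t ^ 2)%N : nat)%:Z)] i.

(* The line [2 k x0 - x1 = k^2] is tangent to the parabola at [(k, k^2)]; of its
   points with integral abscissa, only that one violates the row for [k]. *)
Definition tangent_rows (u : {ffun T -> bool}) (k : T) : int * int * int :=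
  if u k then ((2 * k)%N%:Z, -1, ((k ^ 2)%N : nat)%:Z - 1) else (0, 0, 0).

Hypothesis N_small : (N ^ 2 <= 2 ^ L)%N.
Hypothesis N_gt1 : (1 < N)%N.

(** At [(t, t^2)] the row for [k] amounts to [(t - k)^2 >= 1], which fails only for [t = k]. *)
Lemma parabola_feasible r (z : T * {ffun 'I_r -> {ffun T -> bool}}) :
  (exists x : 'cV[R]_d, feasible (fun k : 'I_r.+1 =>
     if unlift ord0 k is Some j then planar (tangent_rows (z.2 j)) else planar (point_rows z.1)) x)
  <-> [forall j, ~~ z.2 j z.1].
Proof.
have bits (m : int) : `|m| < (N ^ 2)%N%:Z -> clip m = m.
  move=> lt; apply: clip_id; apply: lt_le_trans lt _.
  by rewrite -natrX -[X in X%:R]/(2 ^ L)%N natz lez_nat.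
have bT (t : T) : (t < N)%N := ltn_ord t.
have b0 : clip 0 = 0 by apply: bits; rewrite normr0; nia.
have b1 : clip 1 = 1 by apply: bits; nia.
have bN1 : clip (-1) = -1 by apply: bits; nia.
have bt (t : T) : clip (t : nat)%:Z = (t : nat)%:Z by apply: bits; have := bT t; nia.
have bNt (t : T) : clip (- (t : nat)%:Z) = - (t : nat)%:Z by apply: bits; have := bT t; nia.
have b2t (t : T) : clip ((2 * t)%N%:Z) = (2 * t)%N%:Z by apply: bits; have := bT t; nia.
have bt2 (t : T) : clip ((t ^ 2)%N%:Z) = (t ^ 2)%N%:Z by apply: bits; have := bT t; nia.
have bNt2 (t : T) : clip (- (t ^ 2)%N%:Z) = - (t ^ 2)%N%:Z by apply: bits; have := bT t; nia.
have bt21 (t : T) : clip ((t ^ 2)%N%:Z - 1) = (t ^ 2)%N%:Z - 1 by apply: bits; have := bT t; nia.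
case: z => t g /=; split=> [[x fx]|/forallP lg].
  have f0 i : (clip (point_rows t i).1.1)%:~R * x0 x + (clip (point_rows t i).1.2)%:~R * x1 x
      <= (clip (point_rows t i).2)%:~R.
    by have := fx ord0; rewrite unlift_none => /(_ i); rewrite planar_row mxE.
  have := f0 (inord 0); have := f0 (inord 1); have := f0 (inord 2); have := f0 (inord 3).
  rewrite /point_rows !inordK //= !(b0, b1, bN1, bt, bNt, bt2, bNt2).
  move=> h1 h2 h3 h4.
  apply/forallP => j; apply/negP => ujt.
  have := fx (lift ord0 j); rewrite liftK => /(_ t); rewrite planar_row mxE /tangent_rows ujt.
  rewrite b2t bN1 bt21.
  have e0 : x0 x = t%:R by move: h1 h2 h3 h4; rewrite !rmorphN /=; lra.
  have e1 : x1 x = (t ^ 2)%N%:R by move: h1 h2 h3 h4; rewrite !rmorphN /=; lra.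
  rewrite e0 e1 rmorphB rmorphN /= -!pmulrn natrM natrX expr2; lra.
pose x : 'cV[R]_d := \col_i (if i == 0 :> nat then t%:R else if i == 1 :> nat then (t ^ 2)%N%:R else 0).
have e0 : x0 x = t%:R by rewrite /x0 mxE.
have e1 : x1 x = (t ^ 2)%N%:R by rewrite /x1 mxE.
exists x => k; case: (unliftP ord0 k) => [j|] _.
  move=> i; rewrite planar_row mxE /tangent_rows e0 e1; case: ifP => ui; last first.
    by rewrite b0 !mul0r addr0.
  rewrite b2t bN1 bt21 rmorphB rmorphN /=.
  have ti : (t : nat) <> i.
    by move=> ti; have := lg j; rewrite (_ : t = i) ?ui //; apply: val_inj.
  have : ((2 * i * t + 1)%N%:R <= (i ^ 2 + t ^ 2)%N%:R :> R) by rewrite ler_nat; nia.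
  rewrite !natrD natrM; lra.
move=> i; rewrite planar_row mxE e0 e1 /point_rows.
case: i => [[|[|[|[|//]]]] lti] /=; rewrite !(b0, b1, bN1, bt, bNt, bt2, bNt2) ?rmorphN /=; lra.
Qed.

End Parabola.

Lemma no_constraint_feasible s : exists x : 'cV[R]_d, feasible (fun _ : 'I_s => no_constraint) x.
Proof. by exists 0 => i []. Qed.

Lemma contradiction_infeasible s (i : 'I_s) : (0 < L)%N ->
  ~ exists x : 'cV[R]_d, feasible (fun k => if k == i then contradiction_row else no_constraint) x.
Proof.
move=> L0 [x /(_ i)]; rewrite eqxx => /(_ ord0); rewrite planar_row mxE /=.
rewrite [clip 0]clip_id ?normr0 ?exprn_gt0 // clip_id; last first.
  by rewrite normrN1 exprn_egt1 // -lt0n.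
rewrite !mul0r rmorphN /=; lra.
Qed.

End PlanarConstraints.

(** * Lower bounds for every problem that decides feasibility *)

Section LowerBounds.
Variables (R : realType) (d' r L : nat).
Let d := d'.+2.
Variables (Y A : Type)
  (cor : ('I_r.+1 -> constraints d L) -> Y -> A -> Prop) (y0 : Y) (ok : A -> bool).
Let Pb := Problem cor.
Hypothesis decides : forall K a, cor K y0 a -> ok a <-> exists x : 'cV[R]_d, feasible K x.
Hypothesis L_gt0 : (0 < L)%N.

Lemma decides_no_constraint a : cor (fun=> no_constraint d' L) y0 a -> ok a.
Proof. by move=> /decides [_]; apply; exact: no_constraint_feasible. Qed.

Lemma decides_contradiction i a :
  cor (fun k => if k == i then contradiction_row d' L else no_constraint d' L) y0 a -> ~~ ok a.
Proof.
by move=> /decides[+ _]; case: (ok a) => // /(_ isT) /(contradiction_infeasible L_gt0).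
Qed.

Lemma decides_index c : (4 * (c + 5) <= L)%N -> forall z a,
  cor (index_input (Pb := Pb) (fun t : 'I_(4 ^ (c + 5)) => planar d' L (point_rows t))
    (fun u => planar d' L (tangent_rows u)) z) y0 a -> ok a = @legal 'I_(4 ^ (c + 5)) r z.
Proof.
move=> cL z a /decides okP.
have N_small : ((4 ^ (c + 5)) ^ 2 <= 2 ^ L)%N.
  by rewrite (_ : 4 = 2 ^ 2)%N // -!expnM leq_exp2l //; lia.
have N_gt1 : (1 < 4 ^ (c + 5))%N by rewrite (@ltn_exp2l 4 0) // addnS.
have feasibleP := parabola_feasible R d' N_small N_gt1 z.
by apply/idP/idP => [/okP/feasibleP|/feasibleP/okP].
Qed.

(** For [L < 40] the bound [s <= 3 * n] suffices, as [40 * 3 = 120]. For larger [L] the index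
    problem is used on [4 ^ (c + 5)] points, whose squares fit into [L] bits. *)
Lemma coord_lower_bound cm n : (0 < r)%N ->
  coord_solvable cm Pb n -> (r.+1 * L <= 120 * n)%N.
Proof.
move=> r0 [p [m [Pr [_ Pr_succeeds]]]].
have s_le : (r.+1 <= 3 * n)%N.
  exact: (coord_or_bound_run (Pr_succeeds ^~ y0) decides_no_constraint decides_contradiction).
have [L40|L40] := ltnP L 40; first by nia.
pose c := (L %/ 4 - 5)%N.
have cL : (4 * (c + 5) <= L)%N by rewrite /c; lia.
have := @coord_index_bound_run _ r Pb y0 _ _ ok (decides_index cL) _ _ _ _ (Pr_succeeds ^~ y0) c (card_ord _).
(* The threshold 40 ensures that the loss of 5 and the rounding leave at least half of [L / 4]. *)
have : (L <= 8 * c.+1)%N by rewrite /c; lia.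
by move: (c.+1) => e; nia.
Qed.

Lemma board_lower_bound cm n : (0 < r)%N ->
  board_solvable cm Pb n -> (r.+1 + L <= 63 * n)%N.
Proof.
move=> r0 [p [m [Pr [_ Pr_succeeds]]]].
have s_le : (r.+1 <= 3 * n)%N.
  exact: (board_or_bound_run (Pr_succeeds ^~ y0) decides_no_constraint decides_contradiction).
have [L40|L40] := ltnP L 40; first by lia.
pose c := (L %/ 4 - 5)%N.
have cL : (4 * (c + 5) <= L)%N by rewrite /c; lia.
have := @board_index_bound_run _ r Pb y0 _ _ ok (decides_index cL) _ _ _ _ (Pr_succeeds ^~ y0) c r0 (card_ord _).
by rewrite /c; lia.
Qed.

End LowerBounds.

Definition lp_feasible_answer (R : realType) d (a : lp_answer R d) : bool :=
  if a is Infeasible then false else true.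

Lemma zero_objective_bits d L j : `|(0 : 'cV[int]_d) j 0| < 2 ^+ L.
Proof. by rewrite mxE normr0 exprn_gt0. Qed.

Definition zero_objective d L : objective d L := Objective (@zero_objective_bits d L).

(** With the zero objective even a claim of unboundedness yields a feasible point, at level 0. *)
Lemma lp_decides (R : realType) d L s (K : 'I_s -> constraints d L) (a : lp_answer R d) :
  lp_correct K (zero_objective d L) a ->
  lp_feasible_answer a <-> exists x : 'cV[R]_d, feasible K x.
Proof.
case: a => [|/(_ 0)[x fx _]|x [fx _]] /=; last 2 first.
- by split=> // _; exists x.
- by split=> // _; exists x.
by move=> infeas; split=> // -[x /infeas].
Qed.

(** * Assembling the asymptotic bounds *)

Lemma tilde_O_const (R : realType) (f : nat -> nat -> \bar R) (g : nat -> nat -> nat) (C : nat) :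
  (forall s L, (2 <= s)%N -> (1 <= L)%N -> (f s L <= (C * g s L)%:R%:E)%E) ->
  tilde_O f (fun s L => (g s L)%:R).
Proof.
(* Exponent 0 means no logarithmic factor; the successor keeps the constant positive when
   [C = 0]. *)
move=> H; exists C.+1%:R, 0%N; split=> [|s L s2 L1]; first by rewrite ltr0n.
apply: le_trans (H s L s2 L1) _; rewrite expr0 mulr1 lee_fin natrM.
by rewrite ler_wpM2r // ler_nat.
Qed.

Lemma tilde_Omega_const (R : realType) (S : nat -> nat -> set nat) (g : nat -> nat -> nat)
    (C : nat) : (0 < C)%N ->
  (forall s L n, (2 <= s)%N -> (1 <= L)%N -> S s L n -> (g s L <= C * n)%N) ->
  tilde_Omega (fun s L => ereal_inf [set (n%:R : R)%:E | n in S s L])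
    (fun s L => (g s L)%:R).
Proof.
move=> C0 H; exists C%:R^-1, 0%N; split=> [|s L s2 L1]; first by rewrite invr_gt0 ltr0n.
apply/ereal_infP => _ [n Sn <-]; rewrite expr0 divr1 lee_fin ler_pdivrMl ?ltr0n //.
by rewrite -natrM ler_nat; apply: H.
Qed.

Theorem theorem1p2 (R : realType) (cm : coin_model) (d : nat) :
  ((1 <= d)%N ->
     tilde_O (fun s L => coord_complexity R cm (linear_programming R d L s))
             (fun s L => (s * L)%:R%R))
  /\
  ((2 <= d)%N ->
     [/\ tilde_Theta
           (fun s L => coord_complexity R cm (linear_programming R d L s))
           (fun s L => (s * L)%:R%R),
         tilde_Omega
           (fun s L => coord_complexity R cm (lp_feasibility R d L s))
           (fun s L => (s * L)%:R%R),
         tilde_Omega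
           (fun s L => board_complexity R cm (linear_programming R d L s))
           (fun s L => (s + L)%:R%R)
       & tilde_Omega
           (fun s L => board_complexity R cm (lp_feasibility R d L s))
           (fun s L => (s + L)%:R%R)]).
Proof.
have upper : tilde_O (fun s L => coord_complexity R cm (linear_programming R d L s))
             (fun s L => (s * L)%:R%R).
  have [C solvable] := lp_coord_solvable R d.
  apply: (@tilde_O_const _ _ _ C) => s L s2 L1; apply: ereal_inf_lbound.
  by exists (C * (s * L))%N => //; apply: solvable => //; apply: ltnW.
(* Two coordinates carry the parabola; below, [s >= 2] leaves a server besides the one that holds
   the point. *)
split=> // d2; case: d d2 upper => [|[|d]] // _ upper.
have coord_lp : tilde_Omega (fun s L => coord_complexity R cm (linear_programming R d.+2 L s))
    (fun s L => (s * L)%:R).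
  apply: (@tilde_Omega_const R (fun s L => [set n | coord_solvable cm
    (linear_programming R d.+2 L s) n]%classic) _ 120) => // -[|[|r]] L n // _ L0.
  exact: (@coord_lower_bound R d r.+1 L _ _ _ (zero_objective _ _) _ (@lp_decides R _ L _)).
have coord_feas : tilde_Omega (fun s L => coord_complexity R cm (lp_feasibility R d.+2 L s))
    (fun s L => (s * L)%:R).
  apply: (@tilde_Omega_const R (fun s L => [set n | coord_solvable cm
    (lp_feasibility R d.+2 L s) n]%classic) _ 120) => // -[|[|r]] L n // _ L0.
  exact: (@coord_lower_bound R d r.+1 L _ _ _ tt id).
split=> //.
- apply: (@tilde_Omega_const R (fun s L => [set n | board_solvable cm
    (linear_programming R d.+2 L s) n]%classic) _ 63) => // -[|[|r]] L n // _ L0.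
  exact: (@board_lower_bound R d r.+1 L _ _ _ (zero_objective _ _) _ (@lp_decides R _ L _)).
apply: (@tilde_Omega_const R (fun s L => [set n | board_solvable cm
  (lp_feasibility R d.+2 L s) n]%classic) _ 63) => // -[|[|r]] L n // _ L0.
exact: (@board_lower_bound R d r.+1 L _ _ _ tt id).
Qed.
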